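(* Let $V$ be a grading-restricted vertex superalgebra, $g$ an automorphism of $V$ and $W$ a lower-bounded generalized $g$-twisted $V$-module with twisted vertex operator map $Y_W^g$. For $v_{1}, \dots, v_{k}\in V$, $w\in W$, $w'\in W'$, $p\in \mathbb{Z}$ and $\sigma\in S_{k}$, $$F^{p}(\langle w', Y_{W}^{g}(v_{1}, z_{1})\cdots Y_{W}^{g}(v_{k}, z_{k})w\rangle) =\pm F^{p}(\langle w', Y_{W}^{g}(v_{\sigma(1)}, z_{\sigma(1)})\cdots Y_{W}^{g}(v_{\sigma(k)}, z_{\sigma(k)})w\rangle),$$ where the sign $\pm$ is uniquely determined by $|v_{1}|, \dots, |v_{k}|$ and $\sigma$.
   Context: Conventions: $\mathbb N=\{0,1,2,\dots\}$. For $z\in\mathbb C^\times$ and $p\in\mathbb Z$, $l_p(z)=\log|z|+i\arg z+2p\pi i$ with $0\le\arg z<2\pi$. $x$ and $\log x$ are formal variables; $W\{x\}$ denotes formal series $\sum_{n\in\mathbb C}w_nx^n$, $w_n\in W$. Elements of $V$, $W$ are taken of pure parity, so $|\cdot|$ is defined. A grading-restricted vertex superalgebra is a $\frac{\mathbb Z}{2}$-graded complex vector space $V=\coprod_{n\in\frac{\mathbb Z}{2}}V_{(n)}$ with a linear map $Y_V:V\otimes V\to V[[x,x^{-1}]]$ and a vacuum $\mathbf 1\in V_{(0)}$ such that: (i) $\dim V_{(n)}<\infty$ and $V_{(n)}=0$ for $n$ sufficiently negative; with $L_V(0)v=nv$ for $v\in V_{(n)}$, $[L_V(0),Y_V(v,x)]=x\frac{d}{dx}Y_V(v,x)+Y_V(L_V(0)v,x)$;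 (ii) $Y_V(\mathbf 1,x)=1_V$ and $\lim_{x\to0}Y_V(u,x)\mathbf 1=u$; (iii) with $L_V(-1)v=\lim_{x\to0}\frac{d}{dx}Y_V(v,x)\mathbf 1$, $\frac{d}{dx}Y_V(v,x)=Y_V(L_V(-1)v,x)=[L_V(-1),Y_V(v,x)]$; (iv) duality: with $|u|=0$ for $u\in\coprod_{n\in\mathbb Z}V_{(n)}$ and $|u|=1$ for $u\in\coprod_{n\in\mathbb Z+\frac12}V_{(n)}$, for $v\in V$, $v'\in V'$ (graded dual) the series $\langle v',Y_V(u_1,z_1)Y_V(u_2,z_2)v\rangle$, $(-1)^{|u_1||u_2|}\langle v',Y_V(u_2,z_2)Y_V(u_1,z_1)v\rangle$, $\langle v',Y_V(Y_V(u_1,z_1-z_2)u_2,z_2)v\rangle$ converge absolutely in $|z_1|>|z_2|>0$, $|z_2|>|z_1|>0$, $|z_2|>|z_1-z_2|>0$, respectively, to a common rational function with only possible poles at $z_1=0,z_2=0,z_1=z_2$. An automorphism $g$ of $V$ is a weight-preserving invertible linear map with $gY_V(u,x)v=Y_V(gu,x)gv$. A generalized $g$-twisted $V$-module is a $\mathbb C\times\mathbb Z_2\times\mathbb C/\mathbb Z$-graded space $W=\coprod_{n\in\mathbb C,s\in\mathbb Z_2,\alpha\in P_W}W_{[n]}^{s;[\alpha]}$ (weight, fermion number, $g$-weight; $P_W\subset\{\alpha:0\le\Re(\alpha)<1\}$), $|w|=s$ for $w$ of fermion number $s$, with operators $L_W(0),L_W(-1)$, an action of $g$, and a linear map $Y_W^g:V\otimes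 W\to W\{x\}[\log x]$ such that, writing $(Y_W^g)^p(v,z)$ for the result of substituting $x^n=e^{nl_p(z)}$, $\log x=l_p(z)$: (1) $(Y_W^g)^{p+1}(gv,z)w=(Y_W^g)^p(v,z)w$; (2) $Y_W^g(\mathbf 1,x)w=w$; (3) duality: for $u,v\in V$, $w\in W$, $w'\in W'$ (graded dual) there is $f(z_1,z_2)=\sum_{i,j,k,l=0}^Na_{ijkl}z_1^{m_i}z_2^{n_j}(\log z_1)^k(\log z_2)^l(z_1-z_2)^{-t}$ ($m_i,n_j\in\mathbb C$, $t\in\mathbb Z_+$) such that for all $p\in\mathbb Z$ the series $\langle w',(Y_W^g)^p(u,z_1)(Y_W^g)^p(v,z_2)w\rangle$, $(-1)^{|u||v|}\langle w',(Y_W^g)^p(v,z_2)(Y_W^g)^p(u,z_1)w\rangle$, $\langle w',(Y_W^g)^p(Y_V(u,z_1-z_2)v,z_2)w\rangle$ converge absolutely in $|z_1|>|z_2|>0$, $|z_2|>|z_1|>0$, $|z_2|>|z_1-z_2|>0$, and their sums equal the branch $f^{p,p}$ (obtained with $z_i^{m}=e^{ml_p(z_i)}$, $\log z_i=l_p(z_i)$) in $|z_1|>|z_2|>0$, in $|z_2|>|z_1|>0$, and in $|z_2|>|z_1-z_2|>0$, $|\arg z_1-\arg z_2|<\frac\pi2$, respectively; (4) $L_W(0)-n$ is nilpotent on each element of $W_{[n]}$; $[L_W(0),Y_W^g(v,x)]=x\frac d{dx}Y_W^g(v,x)+Y_W^g(L_V(0)v,x)$; $g-e^{2\pi i\alpha}$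 is nilpotent on each element of $W^{[\alpha]}$; $gY_W^g(u,x)w=Y_W^g(gu,x)gw$; $|Y_W^g(u,x)w|=|u|+|w|$; (5) $\frac d{dx}Y_W^g(v,x)=[L_W(-1),Y_W^g(v,x)]$ (then also $=Y_W^g(L_V(-1)v,x)$). Here $W_{[n]}=\coprod_{s,\alpha}W_{[n]}^{s;[\alpha]}$ and $W^{[\alpha]}=\coprod_{n,s}W_{[n]}^{s;[\alpha]}$. It is lower-bounded if for some $B\in\mathbb R$, $W_{[n]}=0$ whenever $\Re(n)<B$. $V^{[\alpha]}$ is the generalized eigenspace of $g$ on $V$ with eigenvalue $e^{2\pi i\alpha}$, $0\le\Re(\alpha)<1$. Notation $F^p$: for $v_i\in V^{[\alpha_i]}$, the series $\langle w', (Y_{W}^{g})^{p}(v_{1}, z_{1})\cdots (Y_{W}^{g})^{p}(v_{k}, z_{k})w\rangle$ converges absolutely in $|z_1|>\cdots>|z_k|>0$ and its sum there equals a function $$\sum_{n_{1}, \dots, n_{k}=0}^{N}f_{n_{1}\cdots n_{k}}(z_{1}, \dots,z_{k})e^{-\alpha_{1}l_{p}(z_{1})}\cdots e^{-\alpha_{k}l_{p}(z_{k})}(l_{p}(z_{1}))^{n_{1}}\cdots (l_{p}(z_{k}))^{n_{k}}$$ with $N\in\mathbb N$ and $f_{n_1\cdots n_k}$ rational functions (independent of $p$) with only possible poles at $z_i=0$ and $z_i=z_j$, $i\neq j$. $F^{p}(\langle w', Y_{W}^{g}(v_{1}, z_{1})\cdots Y_{W}^{g}(v_{k}, z_{k})w\rangle)$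 denotes this function, on the whole set of $(z_1,\dots,z_k)$ with $z_i\ne0$, $z_i\neq z_j$; it is extended multilinearly to arbitrary $v_i\in V$. *)

(* Defs.v *)
From HB Require Import structures.
From mathcomp Require Import all_boot all_order all_fingroup all_algebra.
From mathcomp Require Import finmap complex.
From mathcomp Require Import all_classical all_reals all_analysis.
From mathcomp Require mpoly.

Set Implicit Arguments.
Unset Strict Implicit.
Unset Printing Implicit Defensive.
Import Order.TTheory GRing.Theory Num.Theory.
Local Open Scope classical_set_scope.
Local Open Scope ring_scope.

Section ComplexFunctions.
Variable R : realType.
Implicit Types (z : R[i]) (p : int).

(* The absolute value as an element of R; the norm of R[i] is R[i]-valued. *)
Definition cmod z : R := complex.Re `|z|.

Definition cexp z : R[i] :=
  Complex (expR (complex.Re z) * cos (complex.Im z))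
          (expR (complex.Re z) * sin (complex.Im z)).

(* The argument with 0 <= carg z < 2 pi, for z != 0. *)
Definition carg z : R :=
  let t := acos (complex.Re z / cmod z) in
  if 0 <= complex.Im z then t else 2 * pi - t.

(* The branch l_p of the logarithm. *)
Definition lp p z : R[i] := Complex (ln (cmod z)) (carg z + 2 * pi * p%:~R).

(* x^n (log x)^k with x^n = e^{n l_p(z)} and log x = l_p(z); d = (n, k). *)
Definition mono p z (d : R[i] * nat) : R[i] :=
  cexp (d.1 * lp p z) * lp p z ^+ d.2.

(* e^{2 pi i a} *)
Definition cexp2pi (a : R[i]) : R[i] := cexp (Complex 0 (2 * pi) * a).

End ComplexFunctions.

Section AbsoluteConvergence.
Variables (R : realType) (I : choiceType).
Implicit Type t : I -> R[i].

Definition abs_summable t : Prop :=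
  summable [set: I] (fun i => (cmod (t i))%:E).

Definition abs_sums_to t (s : R[i]) : Prop :=
  abs_summable t /\
  forall e : R, 0 < e -> exists J0 : {fset I}, forall J : {fset I},
    (J0 `<=` J)%fset -> cmod (\sum_(i <- J) t i - s) < e.

End AbsoluteConvergence.

Section ConfigurationSpace.
Variables (R : realType) (k : nat).
Implicit Type z : 'I_k -> R[i].

Definition in_config z : Prop :=
  (forall i, z i != 0) /\ (forall i j, i != j -> z i != z j).

(* |z_1| > ... > |z_k| > 0 *)
Definition in_ordered_region z : Prop :=
  (forall i, z i != 0) /\
  (forall i j : 'I_k, (i < j)%N -> cmod (z j) < cmod (z i)).

(* Rational functions with only possible poles at z_i = 0 and z_i = z_j. *)
Definition config_rational (f : ('I_k -> R[i]) -> R[i]) : Prop :=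
  exists (P : mpoly.mpoly k R[i]) (m t : nat), forall z, in_config z ->
    f z = mpoly.meval z P /
          ((\prod_(i < k) z i) ^+ m *
           (\prod_(i < k) \prod_(j < k | (i < j)%N) (z i - z j)) ^+ t).

End ConfigurationSpace.

Definition pair_fun (T : Type) (x y : T) : 'I_2 -> T :=
  fun i => if i == ord0 then x else y.

Section GradedSpaces.
Variables (R : realType) (I : choiceType) (E : lmodType R[i]).
Variable G : I -> set E.

(* The coproduct of the G i over the i satisfying P, inside E. *)
Definition in_coprod (P : set I) (v : E) : Prop :=
  exists (J : {fset I}) (f : I -> E),
    (forall i, i \in J -> P i /\ G i (f i)) /\ v = \sum_(i <- J) f i.

(* E is the internal direct sum of the subspaces G i. *)
Record is_grading : Prop := IsGrading {
  grading0 : forall i, G i 0;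
  gradingP : forall i (a : R[i]) u v, G i u -> G i v -> G i (a *: u + v);
  grading_span : forall v, in_coprod [set: I] v;
  grading_free : forall (J : {fset I}) (f : I -> E),
    (forall i, i \in J -> G i (f i)) -> \sum_(i <- J) f i = 0 ->
    forall i, i \in J -> f i = 0
}.

(* The coproduct of the dual spaces of the G i. *)
Definition in_graded_dual (f : {scalar E}) : Prop :=
  exists J : {fset I}, forall i v, i \notin J -> G i v -> f v = 0.

End GradedSpaces.

(* T - a is nilpotent on v. *)
Definition nilpotent_on (R : realType) (E : lmodType R[i]) (T : E -> E)
    (a : R[i]) (v : E) : Prop :=
  exists m : nat, iter m (fun u => T u - a *: u) v = 0.

Section VertexSuperalgebraAxioms.
Variables (R : realType) (V : lmodType R[i]).
(* vwt h is V_(h/2), and Y u v n is the coefficient of x^n in Y_V(u,x)v. *)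
Variables (vwt : int -> set V) (Y : V -> V -> int -> V).

Definition vsa_parity (s : bool) (v : V) : Prop :=
  in_coprod vwt [set h : int | odd `|h|%N = s] v.

Definition vsa_duality : Prop :=
  forall (s1 s2 : bool) (u1 u2 v : V) (v' : {scalar V}),
    vsa_parity s1 u1 -> vsa_parity s2 u2 -> in_graded_dual vwt v' ->
  exists f : ('I_2 -> R[i]) -> R[i], config_rational f /\
  forall z1 z2 : R[i],
  [/\ 0 < cmod z2 < cmod z1 ->
        abs_sums_to (fun d : int * int =>
          v' (Y u1 (Y u2 v d.2) d.1) * z1 ^ d.1 * z2 ^ d.2)
          (f (pair_fun z1 z2)),
      0 < cmod z1 < cmod z2 ->
        abs_sums_to (fun d : int * int =>
          (-1) ^+ (s1 && s2) * v' (Y u2 (Y u1 v d.1) d.2) *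
            z1 ^ d.1 * z2 ^ d.2)
          (f (pair_fun z1 z2)) &
      0 < cmod (z1 - z2) < cmod z2 ->
        abs_sums_to (fun d : int * int =>
          v' (Y (Y u1 u2 d.1) v d.2) * (z1 - z2) ^ d.1 * z2 ^ d.2)
          (f (pair_fun z1 z2))].

End VertexSuperalgebraAxioms.

Record vertex_superalgebra (R : realType) := VertexSuperalgebra {
  vsa_sort :> lmodType R[i];
  (* vsa_wt h is the weight space V_(h/2). *)
  vsa_wt : int -> set vsa_sort;
  (* vsa_Y u v n is the coefficient of x^n in Y_V(u,x)v. *)
  vsa_Y : vsa_sort -> vsa_sort -> int -> vsa_sort;
  vsa_vac : vsa_sort;
  vsa_L0 : {linear vsa_sort -> vsa_sort};
  vsa_grading : is_grading vsa_wt;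
  vsa_Y_linearl : forall v n, linear (fun u => vsa_Y u v n);
  vsa_Y_linearr : forall u n, linear (fun v => vsa_Y u v n);
  vsa_vac_wt : vsa_wt 0 vsa_vac;
  vsa_wt_findim : forall h, exists (d : nat) (e : 'I_d -> vsa_sort),
    forall v, vsa_wt h v -> exists c : 'I_d -> R[i], v = \sum_i c i *: e i;
  vsa_wt_lower : exists B : int, forall h v, h < B -> vsa_wt h v -> v = 0;
  vsa_L0E : forall h v, vsa_wt h v -> vsa_L0 v = (h%:~R / 2) *: v;
  vsa_L0_comm : forall v u n,
    vsa_L0 (vsa_Y v u n) - vsa_Y v (vsa_L0 u) n =
    n%:~R *: vsa_Y v u n + vsa_Y (vsa_L0 v) u n;
  vsa_Y_vac : forall u n, vsa_Y vsa_vac u n = if n == 0 then u else 0;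
  vsa_creation0 : forall u, vsa_Y u vsa_vac 0 = u;
  vsa_creation_lt0 : forall u n, n < 0 -> vsa_Y u vsa_vac n = 0;
  (* L_V(-1)v = lim d/dx Y_V(v,x)1 is the coefficient of x^1 in Y_V(v,x)1. *)
  vsa_Lm1_deriv : forall v u n,
    (n + 1)%:~R *: vsa_Y v u (n + 1) = vsa_Y (vsa_Y v vsa_vac 1) u n;
  vsa_Lm1_comm : forall v u n,
    (n + 1)%:~R *: vsa_Y v u (n + 1) =
    vsa_Y (vsa_Y v u n) vsa_vac 1 - vsa_Y v (vsa_Y u vsa_vac 1) n;
  vsa_dual : vsa_duality vsa_wt vsa_Y
}.

Definition parity (R : realType) (V : vertex_superalgebra R) :
  bool -> V -> Prop := vsa_parity (@vsa_wt R V).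

Record is_automorphism (R : realType) (V : vertex_superalgebra R)
    (g : {linear V -> V}) : Prop := IsAutomorphism {
  aut_bij : bijective g;
  aut_wt : forall h v, vsa_wt h v -> vsa_wt h (g v);
  aut_Y : forall u v n, g (vsa_Y u v n) = vsa_Y (g u) (g v) n
}.

(* V^{[a]} for a in the strip 0 <= Re a < 1. *)
Definition gen_eigen (R : realType) (V : vertex_superalgebra R) (g : V -> V)
  (a : R[i]) (v : V) : Prop := nilpotent_on g (cexp2pi a) v.

Section TwistedModuleAxioms.
Variables (R : realType) (V : vertex_superalgebra R) (g : {linear V -> V}).
Variable W : lmodType R[i].
(* wgr (n, s, a) is W_{[n]}^{s;[a]}, and YW v w (n, k) is the coefficient of
   x^n (log x)^k in Y_W^g(v,x)w. *)
Variables (wgr : R[i] * bool * R[i] -> set W) (YW : V -> W -> R[i] * nat -> W).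

(* Sums are taken in the completion of W, hence tested against W'. *)
Definition tw_equivariance : Prop :=
  forall (v : V) (w : W) (w' : {scalar W}) (p : int) (z : R[i]),
    in_graded_dual wgr w' -> z != 0 ->
  exists s : R[i],
    abs_sums_to (fun d : R[i] * nat => w' (YW (g v) w d) * mono (p + 1) z d) s /\
    abs_sums_to (fun d : R[i] * nat => w' (YW v w d) * mono p z d) s.

Definition tw_duality_fun (N : nat) (a : 'I_N.+1 -> 'I_N.+1 -> 'I_N.+1 ->
    'I_N.+1 -> R[i]) (m n : 'I_N.+1 -> R[i]) (t : nat) (p : int)
    (z1 z2 : R[i]) : R[i] :=
  \sum_i \sum_j \sum_k \sum_l
    a i j k l * mono p z1 (m i, k : nat) * mono p z2 (n j, l : nat)
      * (z1 - z2) ^- t.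

Definition tw_duality : Prop :=
  forall (s1 s2 : bool) (u v : V) (w : W) (w' : {scalar W}),
    parity s1 u -> parity s2 v -> in_graded_dual wgr w' ->
  exists (N : nat) a (m n : 'I_N.+1 -> R[i]) (t : nat),
  forall (p : int) (z1 z2 : R[i]),
  let f := tw_duality_fun a m n t p z1 z2 in
  let iterate := fun d : int * (R[i] * nat) =>
    w' (YW (vsa_Y u v d.1) w d.2) * (z1 - z2) ^ d.1 * mono p z2 d.2 in
  [/\ 0 < cmod z2 < cmod z1 ->
        abs_sums_to (fun d : (R[i] * nat) * (R[i] * nat) =>
          w' (YW u (YW v w d.2) d.1) * mono p z1 d.1 * mono p z2 d.2) f,
      0 < cmod z1 < cmod z2 ->
        abs_sums_to (fun d : (R[i] * nat) * (R[i] * nat) =>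
          (-1) ^+ (s1 && s2) * w' (YW v (YW u w d.1) d.2) *
            mono p z1 d.1 * mono p z2 d.2) f,
      0 < cmod (z1 - z2) < cmod z2 -> abs_summable iterate &
      0 < cmod (z1 - z2) < cmod z2 -> `|carg z1 - carg z2| < pi / 2 ->
        abs_sums_to iterate f].

End TwistedModuleAxioms.

Record twisted_module (R : realType) (V : vertex_superalgebra R)
    (g : {linear V -> V}) := TwistedModule {
  tw_sort :> lmodType R[i];
  (* tw_gr (n, s, a) is W_{[n]}^{s;[a]}: weight n, fermion number s (true is
     odd), g-weight a. *)
  tw_gr : R[i] * bool * R[i] -> set tw_sort;
  tw_P : set R[i];
  (* tw_Y v w (n, k) is the coefficient of x^n (log x)^k in Y_W^g(v,x)w. *)
  tw_Y : V -> tw_sort -> R[i] * nat -> tw_sort;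
  tw_L0 : {linear tw_sort -> tw_sort};
  tw_Lm1 : {linear tw_sort -> tw_sort};
  tw_g : {linear tw_sort -> tw_sort};
  tw_grading : is_grading tw_gr;
  tw_P_strip : forall a, tw_P a -> 0 <= complex.Re a < 1;
  tw_gr_P : forall n s a w, tw_gr (n, s, a) w -> ~ tw_P a -> w = 0;
  tw_g_bij : bijective tw_g;
  tw_Y_linearl : forall w d, linear (fun v => tw_Y v w d);
  tw_Y_linearr : forall v d, linear (fun w => tw_Y v w d);
  (* Elements of W{x}[log x] are polynomials in log x. *)
  tw_Y_log : forall v w, exists K : nat, forall n k,
    (K <= k)%N -> tw_Y v w (n, k) = 0;
  tw_equiv : tw_equivariance g tw_gr tw_Y;
  tw_Y_vac : forall w d,
    tw_Y (vsa_vac V) w d = if d == (0, 0%N) then w else 0;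
  tw_dual : tw_duality tw_gr tw_Y;
  tw_L0_nilp : forall n w,
    in_coprod tw_gr [set i | i.1.1 = n] w -> nilpotent_on tw_L0 n w;
  tw_L0_comm : forall v w n k,
    tw_L0 (tw_Y v w (n, k)) - tw_Y v (tw_L0 w) (n, k) =
    n *: tw_Y v w (n, k) + k.+1%:R *: tw_Y v w (n, k.+1) +
      tw_Y (vsa_L0 V v) w (n, k);
  tw_g_nilp : forall a w,
    in_coprod tw_gr [set i | i.2 = a] w -> nilpotent_on tw_g (cexp2pi a) w;
  tw_g_Y : forall u w d, tw_g (tw_Y u w d) = tw_Y (g u) (tw_g w) d;
  tw_Y_parity : forall s1 s2 u w d, parity s1 u ->
    in_coprod tw_gr [set i | i.1.2 = s2] w ->
    in_coprod tw_gr [set i | i.1.2 = s1 (+) s2] (tw_Y u w d);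
  tw_Lm1_comm : forall v w n k,
    (n + 1) *: tw_Y v w (n + 1, k) + k.+1%:R *: tw_Y v w (n + 1, k.+1) =
    tw_Lm1 (tw_Y v w (n, k)) - tw_Y v (tw_Lm1 w) (n, k)
}.

Section LowerBounded.
Variables (R : realType) (V : vertex_superalgebra R) (g : {linear V -> V}).

Definition lower_bounded (W : twisted_module g) : Prop :=
  exists B : R, forall n w, complex.Re n < B ->
    in_coprod (@tw_gr R V g W) [set i | i.1.1 = n] w -> w = 0.

Definition graded_dual (W : twisted_module g) (w' : {scalar W}) : Prop :=
  in_graded_dual (@tw_gr R V g W) w'.

End LowerBounded.

Section Correlators.
Variables (R : realType) (V : vertex_superalgebra R) (g : {linear V -> V}).
Variables (W : twisted_module g) (k : nat) (w' : {scalar W}) (w : W).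
Implicit Types (p : int) (v : 'I_k -> V) (z : 'I_k -> R[i]).

(* The d-th term of <w', (Y_W^g)^p(v_1,z_1) ... (Y_W^g)^p(v_k,z_k) w>. *)
Definition product_term p v z (d : {ffun 'I_k -> R[i] * nat}) : R[i] :=
  w' (foldr (fun i x => tw_Y (v i) x (d i)) w (enum 'I_k)) *
  \prod_i mono p (z i) (d i).

Definition correlator_form (N : nat) (al : 'I_k -> R[i])
    (f : {ffun 'I_k -> 'I_N.+1} -> ('I_k -> R[i]) -> R[i]) p z : R[i] :=
  \sum_(n : {ffun 'I_k -> 'I_N.+1})
    f n z * \prod_i (cexp (- al i * lp p (z i)) * lp p (z i) ^+ n i).

(* Phi p v z is the value of F^p(<w', Y_W^g(v_1,z_1) ... Y_W^g(v_k,z_k) w>)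
   at z, set to 0 outside the configuration space. *)
Record is_correlator (Phi : int -> ('I_k -> V) -> ('I_k -> R[i]) -> R[i]) :
    Prop := IsCorrelator {
  correlator_multilinear : forall p v z i,
    scalar (fun x => Phi p (fun j => if j == i then x else v j) z);
  correlator_eigen : forall (al : 'I_k -> R[i]) v,
    (forall i, 0 <= complex.Re (al i) < 1) ->
    (forall i, gen_eigen g (al i) (v i)) ->
    exists (N : nat) (f : {ffun 'I_k -> 'I_N.+1} -> ('I_k -> R[i]) -> R[i]),
      (forall n, config_rational (f n)) /\
      forall p z,
        (in_ordered_region z ->
           abs_sums_to (product_term p v z) (correlator_form al f p z)) /\
        (in_config z -> Phi p v z = correlator_form al f p z);
  correlator_out : forall p v z, ~ in_config z -> Phi p v z = 0
}.

(* F^p, selected by its characterization, which determines it uniquely. *)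
Definition Fp : int -> ('I_k -> V) -> ('I_k -> R[i]) -> R[i] :=
  xget (fun _ _ _ => 0) [set Phi | is_correlator Phi].

End Correlators.

(* The Koszul sign exponent: the number of pairs of odd entries exchanged in
   passing from v_1, ..., v_k to v_{sigma(1)}, ..., v_{sigma(k)}. *)
Definition koszul (k : nat) (s : 'I_k -> bool) (sigma : 'S_k) : nat :=
  #|[pred ij : 'I_k * 'I_k | [&& (ij.1 < ij.2)%N, (sigma ij.2 < sigma ij.1)%N,
      s (sigma ij.1) & s (sigma ij.2)]]|.

(* Main.v *)
Require Import Defs.
From HB Require Import structures.
From mathcomp Require Import all_boot all_order all_fingroup all_algebra.
From mathcomp Require Import finmap complex ring lra zify.
From mathcomp Require Import all_classical all_reals all_analysis.
From mathcomp Require mpoly.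
Import Order.TTheory GRing.Theory Num.Theory.
Local Open Scope ring_scope.
Set Implicit Arguments.
Unset Strict Implicit.
Unset Printing Implicit Defensive.

(** Both sides are values of one function [Phi] characterized as the correlator (and
  both vanish if there is none). Multilinearity reduces the theorem to elements
  [v i] that are homogeneous for the weight and generalized eigenvectors of [g].
  Since the sign is a cocycle ([koszul_comp]) and adjacent transpositions generate
  the symmetric group ([perm_adjacent_ind]), it remains to exchange two neighbouring
  operators ([adjacent_swap]).

  The region of convergence of the exchanged product is disjoint from that of the
  original one, so the comparison is made on coefficients. Multiplied by enough
  differences [z i - z j], a correlator becomes a finite sum of monomials
  [prod_i z_i^(n_i) (log z_i)^(q_i)] with coefficients independent of the branch
  ([clearable_term]), and the coefficients of this numerator are obtained from those
  of the product of operators by the corresponding formal multiplication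
  ([prod_coef_cleared]). For fixed exponents of the other variables, duality says
  that the two orders agree after multiplication by a power of the difference of the
  two variables ([pair_locality]). The power is not uniform in the other exponents;
  but the difference of the two numerators is finite, multiplication by a difference
  of variables is injective on finite sums, and so the numerators agree
  ([local_eventually_zero]). As finite sums they agree on all branches and at all
  points of the configuration space.

  Passing from functions to coefficients needs the uniqueness of expansions in
  complex powers and logarithms, which fails for arbitrary sets of exponents. Here
  the lower bound on the weights and the equivariance under [g] confine the
  exponents of one operator, applied to a fixed vector, to finitely many
  progressions [a + N], with bounded powers of the logarithm ([operator_support]);
  composing a functional of the graded dual with an operator coefficient gives
  again a functional of the graded dual ([dual_Y]), so the condition passes to
  products, one variable at a time. Under this condition uniqueness is proved at
  positive real points [z_i = e^(x_i)] ([series_unique]): letting the last variable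
  tend to [0] compares a finite exponential polynomial with a remainder of smaller
  order, and difference operators show that its coefficients vanish
  ([exp_poly_zero]). *)


(** * Complex modulus, exponential and logarithm *)

Section ComplexLemmas.
Variable R : realType.
Implicit Types (z w : R[i]) (p : int) (x y : R).
Local Notation "x %:C" := (real_complex R x).

Lemma cmodE z : `|z| = (cmod z)%:C.
Proof. by rewrite /cmod normc_def. Qed.

Lemma cmod_ge0 z : 0 <= cmod z.
Proof. by rewrite -ler0c -cmodE. Qed.

Lemma cmod_eq0 z : (cmod z == 0) = (z == 0).
Proof. by rewrite -(inj_eq (@complexI R)) -cmodE normr_eq0. Qed.

Lemma cmod_gt0 z : (0 < cmod z) = (z != 0).
Proof. by rewrite lt_neqAle cmod_ge0 andbT eq_sym cmod_eq0. Qed.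

Lemma cmodM z w : cmod (z * w) = cmod z * cmod w.
Proof. by apply: complexI; rewrite rmorphM /= -!cmodE normrM. Qed.

Lemma cmodD z w : cmod (z + w) <= cmod z + cmod w.
Proof. by rewrite -lecR rmorphD /= -!cmodE ler_normD. Qed.

Lemma cmodN z : cmod (- z) = cmod z.
Proof. by apply: complexI; rewrite -!cmodE normrN. Qed.

Lemma cmod0 : cmod (0 : R[i]) = 0.
Proof. by apply/eqP; rewrite cmod_eq0. Qed.

Lemma cmodX z n : cmod (z ^+ n) = cmod z ^+ n.
Proof. by apply: complexI; rewrite rmorphXn /= -!cmodE normrX. Qed.

Lemma cmodC x : cmod x%:C = `|x|.
Proof. by apply: complexI; rewrite -cmodE normc_def /= expr0n addr0 sqrtr_sqr. Qed.

Lemma cmod_sum (I : Type) (r : seq I) (P : pred I) (F : I -> R[i]) :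
  cmod (\sum_(i <- r | P i) F i) <= \sum_(i <- r | P i) cmod (F i).
Proof.
elim/big_rec2: _ => [|i y1 y2 _ le12]; first by rewrite cmod0.
by apply: le_trans (cmodD _ _) _; rewrite lerD2l.
Qed.

Lemma cmod_sqr z : cmod z ^+ 2 = complex.Re z ^+ 2 + complex.Im z ^+ 2.
Proof.
by rewrite /cmod normc_def /= sqr_sqrtr // addr_ge0 // sqr_ge0.
Qed.

Lemma Re_le_cmod z : `|complex.Re z| <= cmod z.
Proof.
rewrite -(@ler_pXn2r R 2) ?nnegrE ?cmod_ge0 // cmod_sqr real_normK ?num_real //.
by rewrite lerDl sqr_ge0.
Qed.

Lemma Im_le_cmod z : `|complex.Im z| <= cmod z.
Proof.
rewrite -(@ler_pXn2r R 2) ?nnegrE ?cmod_ge0 // cmod_sqr real_normK ?num_real //.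
by rewrite lerDr sqr_ge0.
Qed.

Lemma ReD z w : complex.Re (z + w) = complex.Re z + complex.Re w.
Proof. by case: z w => ? ? []. Qed.

Lemma ReN z : complex.Re (- z) = - complex.Re z.
Proof. by case: z. Qed.

Lemma Re_nat n : complex.Re (n%:R : R[i]) = n%:R.
Proof. by rewrite -(rmorph_nat (real_complex R)). Qed.

Lemma ReMr z x : complex.Re (z * x%:C) = complex.Re z * x.
Proof. by case: z => a b /=; rewrite mulr0 subr0. Qed.

Lemma cexpD z w : cexp (z + w) = cexp z * cexp w.
Proof.
case: z w => a b [c d]; rewrite /cexp /= expRD cosD sinD.
by apply/eqP; rewrite eq_complex /=; apply/andP; split; apply/eqP; ring.
Qed.

Lemma cexp0 : cexp (0 : R[i]) = 1.
Proof. by rewrite /cexp /= expR0 cos0 sin0 mulr1 mulr0. Qed.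

Lemma cmod_cexp z : cmod (cexp z) = expR (complex.Re z).
Proof.
apply: (@pexpIrn R 2) => //; rewrite ?nnegrE ?cmod_ge0 ?expR_ge0 //.
by rewrite cmod_sqr /= !exprMn -mulrDr cos2Dsin2 mulr1.
Qed.

Lemma cexp_neq0 z : cexp z != 0.
Proof. by rewrite -cmod_gt0 cmod_cexp expR_gt0. Qed.

Lemma cexpN z : cexp (- z) = (cexp z)^-1.
Proof.
by apply: (mulIf (cexp_neq0 z)); rewrite mulVf ?cexp_neq0 // -cexpD addNr cexp0.
Qed.

Lemma cexpMn z n : cexp (n%:R * z) = cexp z ^+ n.
Proof.
elim: n => [|n IH]; first by rewrite mul0r cexp0.
by rewrite -natr1 mulrDl mul1r cexpD IH exprSr.
Qed.

Lemma cexpMz z (m : int) : cexp (m%:~R * z) = cexp z ^ m.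
Proof.
case: m => n; first by rewrite cexpMn.
by rewrite NegzE mulrNz mulNr cexpN cexpMn.
Qed.

Lemma cexpC x : cexp x%:C = (expR x)%:C.
Proof. by rewrite /cexp /= cos0 sin0 mulr1 mulr0. Qed.

Lemma cexp_2pi_int (m : int) : cexp (Complex 0 (2 * pi) * m%:~R) = 1 :> R[i].
Proof.
rewrite mulrC cexpMz.
suff -> : cexp (Complex 0 (2 * pi)) = 1 :> R[i] by rewrite exp1rz.
by rewrite /cexp /= mulr_natl cos2pi sin2pi expR0 mulr1 mulr0.
Qed.

Lemma lp_shift p z : lp p z = lp 0 z + Complex 0 (2 * pi) * p%:~R.
Proof.
rewrite /lp; have -> : (p%:~R : R[i]) = (p%:~R)%:C by rewrite rmorph_int.
apply/eqP; rewrite eq_complex /=; apply/andP; split; apply/eqP; ring.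
Qed.

Lemma cexp_lp p z : z != 0 -> cexp (lp p z) = z.
Proof.
move=> z0; rewrite lp_shift cexpD cexp_2pi_int mulr1.
have c0 : 0 < cmod z by rewrite cmod_gt0.
rewrite /lp /cexp /= mulr0 addr0 lnK ?posrE //.
have b1 : -1 <= complex.Re z / cmod z <= 1.
  by rewrite -ler_norml normrM normfV (gtr0_norm c0) ler_pdivrMr // mul1r Re_le_cmod.
have sE : cmod z * Num.sqrt (1 - (complex.Re z / cmod z) ^+ 2) = `|complex.Im z|.
  rewrite -[X in X * _](gtr0_norm c0) -sqrtr_sqr -sqrtrM ?sqr_ge0 //.
  rewrite mulrBr mulr1 exprMn exprVn mulrCA divff ?mulr1; last first.
    by rewrite expf_neq0 // gt_eqF.
  by rewrite cmod_sqr addrAC subrr add0r sqrtr_sqr.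
have cE : cmod z * (complex.Re z / cmod z) = complex.Re z.
  by rewrite mulrCA divff ?mulr1 // gt_eqF.
rewrite /carg; case: ifP => [Im0|Im0].
  rewrite acosK ?in_itv //= sin_acos // sE cE ger0_norm //.
  by case: (z).
have -> : cos (2 * pi - acos (complex.Re z / cmod z)) = complex.Re z / cmod z.
  by rewrite mulr_natl addrC cosD2pi cosN acosK.
have -> : sin (2 * pi - acos (complex.Re z / cmod z)) =
   - Num.sqrt (1 - (complex.Re z / cmod z) ^+ 2).
  by rewrite mulr_natl addrC sinD2pi sinN sin_acos.
rewrite mulrN sE cE ltr0_norm ?opprK; last by rewrite ltNge Im0.
by case: (z).
Qed.

Lemma lp0_cexp w : 0 <= complex.Im w < 2 * pi -> lp 0 (cexp w) = w.
Proof.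
move=> /andP[h0 h1]; rewrite /lp cmod_cexp expRK mulr0 addr0.
suff -> : carg (cexp w) = complex.Im w by case: (w).
rewrite /carg cmod_cexp /= mulrAC divff ?mul1r ?gt_eqF ?expR_gt0 //.
rewrite pmulr_rge0 ?expR_gt0 //.
have [le_pi|gt_pi] := leP (complex.Im w) pi.
  by rewrite sin_ge0_pi ?h0 //= cosK // in_itv /= h0.
have ltpi : 0 < complex.Im w - pi < pi.
  by rewrite subr_gt0 gt_pi /=; lra.
have : sin (complex.Im w) < 0.
  have -> : complex.Im w = (complex.Im w - pi) + pi by lra.
  by rewrite sinDpi oppr_lt0 sin_gt0_pi.
rewrite ltNge => /negbTE ->.
have -> : cos (complex.Im w) = cos (2 * pi - complex.Im w).
  by rewrite mulr_natl addrC cosD2pi cosN.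
by rewrite cosK ?subKr // in_itv /=; lra.
Qed.

Lemma lp0_exp x : lp 0 (expR x)%:C = x%:C.
Proof. by rewrite -cexpC lp0_cexp //= lexx mulr_gt0 ?pi_gt0. Qed.

Lemma lp_pos p x : lp p (expR x)%:C = x%:C + Complex 0 (2 * pi) * p%:~R.
Proof. by rewrite lp_shift lp0_exp. Qed.

Lemma cexp2piD z w : cexp2pi (z + w) = cexp2pi z * cexp2pi w.
Proof. by rewrite /cexp2pi mulrDr cexpD. Qed.

Lemma cexp2pi_neq0 z : cexp2pi z != 0.
Proof. exact: cexp_neq0. Qed.

Lemma cexp2pi_int (m : int) : cexp2pi (m%:~R : R[i]) = 1.
Proof. exact: cexp_2pi_int. Qed.

(** The logarithm divided by [2 pi i], normalized to the strip that contains the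
  [g]-weights. *)
Definition strip_log z : R[i] := lp 0 z / Complex 0 (2 * pi).

Lemma twopii_neq0 : Complex 0 (2 * pi) != 0 :> R[i].
Proof. by rewrite eq_complex /= eqxx /= mulf_neq0 // gt_eqF ?pi_gt0. Qed.

Lemma strip_logK z : z != 0 -> cexp2pi (strip_log z) = z.
Proof.
by move=> z0; rewrite /cexp2pi /strip_log mulrCA divff ?twopii_neq0 // mulr1 cexp_lp.
Qed.

Lemma cexp2piK (a : R[i]) : 0 <= complex.Re a < 1 -> strip_log (cexp2pi a) = a.
Proof.
move=> /andP[h0 h1]; rewrite /strip_log /cexp2pi lp0_cexp.
  by rewrite mulrAC divff ?twopii_neq0 // mul1r.
case: a h0 h1 => a b /= h0 h1; rewrite mul0r add0r.
by rewrite mulr_ge0 ?mulr_ge0 ?pi_ge0 //= -[ltRHS]mulr1 ltr_pM2l ?mulr_gt0 ?pi_gt0.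
Qed.

Lemma carg_bound z : z != 0 -> 0 <= carg z < 2 * pi.
Proof.
move=> z0; have c0 : 0 < cmod z by rewrite cmod_gt0.
have b1 : -1 <= complex.Re z / cmod z <= 1.
  by rewrite -ler_norml normrM normfV (gtr0_norm c0) ler_pdivrMr // mul1r Re_le_cmod.
have g0 := acos_ge0 b1; have l0 := acos_lepi b1; have p0 := @pi_gt0 R.
rewrite /carg; case: ifP => [Im0|Im0]; first by lra.
suff : acos (complex.Re z / cmod z) != 0.
  by rewrite neq_lt ltNge g0 /=; lra.
apply/eqP => a0; have := acosK b1; rewrite a0 cos0 => /esym/eqP.
rewrite -subr_eq0 -(mulr1 1) -[X in _ - X * _](divff (lt0r_neq0 c0)) mulr1 -mulrBl.
rewrite mulf_eq0 invr_eq0 (gt_eqF c0) orbF subr_eq0 => /eqP rE.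
move: (cmod_sqr z); rewrite rE -{1}[cmod z ^+ 2]addr0 => /addrI/esym/eqP.
by rewrite sqrf_eq0 => /eqP I0; rewrite I0 lexx in Im0.
Qed.

Lemma strip_log_bound z : z != 0 -> 0 <= complex.Re (strip_log z) < 1.
Proof.
move=> z0; have := carg_bound z0; have p0 := @pi_gt0 R => /andP[h0 h1].
have -> : complex.Re (strip_log z) = carg z / (2 * pi).
  rewrite /strip_log /lp /= mulr0 addr0.
  have pn : pi != 0 :> R by rewrite gt_eqF.
  by move: (ln _) (carg z) (pi) pn => l c P pn; field; rewrite ?pn.
have pp : 0 < 2 * pi :> R by rewrite mulr_gt0.
by rewrite divr_ge0 ?(ltW pp) //= ltr_pdivrMr // mul1r.
Qed.

(** Subtracting the integer part of its real part brings the exponent to the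
  strip, where [0] is the only logarithm of [1]. *)
Lemma cexp2pi_eq1 (a : R[i]) : cexp2pi a = 1 -> exists m : int, a = m%:~R.
Proof.
move=> a1; exists (Num.floor (complex.Re a)); apply/eqP; rewrite -subr_eq0.
set b := a - _; have b1 : cexp2pi b = 1.
  by rewrite /b cexp2piD a1 mul1r -rmorphN cexp2pi_int.
have bstrip : 0 <= complex.Re b < 1.
  rewrite /b ReD ReN; have -> : complex.Re ((Num.floor (complex.Re a))%:~R : R[i]) =
    (Num.floor (complex.Re a))%:~R by rewrite -(rmorph_int (real_complex R)).
  by rewrite subr_ge0 floor_le /= ltrBlDl -intrD1 floorD1_gt.
rewrite -(cexp2piK bstrip) b1 -(cexp2piK (a := 0)) /= ?lexx ?ltr01 //.
by rewrite /cexp2pi mulr0 cexp0.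
Qed.

End ComplexLemmas.

(** * Absolutely convergent families *)

Section Summation.
Variable R : realType.
Local Notation "x %:C" := (real_complex R x).
Local Notation Rei := (@complex.Re R).
Local Notation Imi := (@complex.Im R).

Section OneIndex.
Variable I : choiceType.
Implicit Types (t u : I -> R[i]) (s : R[i]) (J : {fset I}).

Lemma abs_summableP t :
  abs_summable t <-> exists M : R, forall J, \sum_(i <- J) cmod (t i) <= M.
Proof.
have E J : (\sum_(i <- J) (cmod (t i))%:E)%E = (\sum_(i \in [set` J]) `|(cmod (t i))%:E|)%E.
  rewrite fsbig_finite //= set_fsetK; apply: eq_bigr => i _.
  by rewrite /= ger0_norm ?cmod_ge0.
split=> [st|[M hM]].
  have st' : (\esum_(i in [set: I]) `|(cmod (t i))%:E| < +oo)%E by [].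
  have e0 : (0 <= \esum_(i in [set: I]) `|(cmod (t i))%:E|)%E by apply: esum_ge0.
  exists (fine (\esum_(i in [set: I]) `|(cmod (t i))%:E|)%E) => J.
  rewrite -lee_fin fineK; last by rewrite ge0_fin_numE.
  rewrite -sumEFin E; apply: ereal_sup_ubound; exists [set` J]%classic => //.
have st : (\esum_(i in [set: I]) `|(cmod (t i))%:E| < +oo)%E; last exact: st.
apply: le_lt_trans (ltry M); apply: ge_ereal_sup => _ [A [finA _] <-].
move: (hM (fset_set A)); rewrite -lee_fin -sumEFin E.
by rewrite fset_setK.
Qed.

Lemma fset_sum_le (a : I -> R) J J' : (forall i, 0 <= a i) -> (J `<=` J')%fset ->
  \sum_(i <- J) a i <= \sum_(i <- J') a i.
Proof.
move=> a0 JJ'; rewrite [leRHS](big_fsetID _ (mem J)) /=.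
have -> : [fset x in J' | x \in J]%fset = J.
  apply/fsetP => x; rewrite !inE /= andbC; case: (boolP (x \in J)) => //= xJ.
  by rewrite (fsubsetP JJ').
by rewrite lerDl sumr_ge0.
Qed.

Lemma sums_eq t u s s' : (forall i, t i = u i) -> s = s' -> abs_sums_to t s ->
  abs_sums_to u s'.
Proof. by move=> /funext -> ->. Qed.

Lemma sums_add t u s s' : abs_sums_to t s -> abs_sums_to u s' ->
  abs_sums_to (fun i => t i + u i) (s + s').
Proof.
move=> [/abs_summableP[M hM] ht] [/abs_summableP[M' hM'] hu]; split.
  apply/abs_summableP; exists (M + M') => J.
  apply: le_trans (lerD (hM J) (hM' J)); rewrite -big_split /=.
  by apply: ler_sum => i _; exact: cmodD.
move=> e e0; have e2 : 0 < e / 2 by rewrite divr_gt0.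
have [J1 h1] := ht _ e2; have [J2 h2] := hu _ e2.
exists (J1 `|` J2)%fset => J; rewrite fsubUset => /andP[/h1 l1 /h2 l2].
rewrite big_split /= opprD addrACA; apply: le_lt_trans (cmodD _ _) _.
by rewrite [ltRHS]splitr ltrD.
Qed.

Lemma sums_scale c t s : abs_sums_to t s -> abs_sums_to (fun i => c * t i) (c * s).
Proof.
move=> [/abs_summableP[M hM] ht]; split.
  apply/abs_summableP; exists (cmod c * M) => J.
  under eq_bigr do rewrite cmodM.
  by rewrite -mulr_sumr ler_wpM2l ?cmod_ge0.
move=> e e0; have c1 : 0 < cmod c + 1 by rewrite ltr_wpDl ?cmod_ge0.
have [J1 h1] := ht (e / (cmod c + 1)) (divr_gt0 e0 c1).
exists J1 => J /h1; rewrite ltr_pdivlMr // -mulr_sumr -mulrBr cmodM; apply: le_lt_trans.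
by rewrite mulrC ler_wpM2l ?cmod_ge0 // lerDl.
Qed.

Lemma sums_sub t u s s' : abs_sums_to t s -> abs_sums_to u s' ->
  abs_sums_to (fun i => t i - u i) (s - s').
Proof.
move=> ht /(sums_scale (-1)) hu; apply: sums_eq (sums_add ht hu) => [i|];
by rewrite mulN1r.
Qed.

Lemma sums_bound t s M : (forall J, \sum_(i <- J) cmod (t i) <= M) ->
  abs_sums_to t s -> cmod s <= M.
Proof.
move=> hM [_ ht]; apply/ler_addgt0Pr => e e0; have [J hJ] := ht e e0.
rewrite -[s](subKr (\sum_(i <- J) t i)); apply: le_trans (cmodD _ _) _.
rewrite cmodN lerD //; last exact/ltW/hJ/fsubset_refl.
by apply: le_trans (hM J); exact: cmod_sum.
Qed.

Lemma sums_uniq t s s' : abs_sums_to t s -> abs_sums_to t s' -> s = s'.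
Proof.
move=> h h'; apply/eqP; rewrite -subr_eq0 -cmod_eq0 eq_le cmod_ge0 andbT.
apply: sums_bound (sums_sub h h') => J.
by rewrite big1 // => i _; rewrite subrr cmod0.
Qed.

Lemma summable_le t u C : 0 <= C -> (forall i, cmod (u i) <= C * cmod (t i)) ->
  abs_summable t -> abs_summable u.
Proof.
move=> C0 le /abs_summableP[M hM]; apply/abs_summableP; exists (C * M) => J.
apply: le_trans (ler_wpM2l C0 (hM J)); rewrite mulr_sumr.
by apply: ler_sum.
Qed.

Lemma nneg_sums_exist (a : I -> R) : (forall i, 0 <= a i) ->
  abs_summable (fun i => (a i)%:C) -> exists s, abs_sums_to (fun i => (a i)%:C) s.
Proof.
move=> a0 sa; have /abs_summableP[M hM] := sa.
have {}hM J : \sum_(i <- J) a i <= M.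
  by apply: le_trans (hM J); rewrite le_eqVlt; apply/orP; left; apply/eqP;
     apply: eq_bigr => i _; rewrite cmodC ger0_norm.
pose A := [set x | exists J, x = \sum_(i <- J) a i]%classic.
have supA : has_sup A.
  split; first by exists (\sum_(i <- fset0) a i), fset0.
  by exists M => _ [J ->].
exists (sup A)%:C; split => // e e0.
have [_ [J0 ->] lt0] := sup_adherent e0 supA; exists J0 => J J0J.
rewrite -rmorph_sum -rmorphB cmodC ltr_norml; apply/andP; split.
  rewrite ltrBrDl; apply: lt_le_trans lt0 _; exact: fset_sum_le.
rewrite ltrBlDr; apply: le_lt_trans (sup_upper_bound supA _) _.
  by exists J.
by rewrite ltrDr.
Qed.

(** Splitting into the positive and negative parts of the real and imaginary parts
  leaves sums of nonnegative terms, whose limit is a supremum. *)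
Lemma sums_exist t : abs_summable t -> exists s, abs_sums_to t s.
Proof.
move=> st.
have part (f : R[i] -> R) : (forall z, 0 <= f z <= cmod z) ->
    exists s, abs_sums_to (fun i => (f (t i))%:C) s.
  move=> hf; apply: nneg_sums_exist => [i|]; first by case/andP: (hf (t i)).
  apply: (summable_le ler01 _ st) => i; rewrite cmodC mul1r.
  by case/andP: (hf (t i)) => h0 h1; rewrite ger0_norm.
have hmax (x y : R) : `|x| <= y -> 0 <= Num.max x 0 <= y.
  by move=> h; rewrite le_max lexx orbT ge_max (le_trans (ler_norm _) h) (le_trans (normr_ge0 _) h).
have [s1 h1] := part (fun z => Num.max (Rei z) 0) (fun z => hmax _ _ (Re_le_cmod z)).
have [s2 h2] := part (fun z => Num.max (- Rei z) 0)
  (fun z => hmax _ _ (eq_ind_r (fun x => x <= _) (Re_le_cmod z) (normrN _))).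
have [s3 h3] := part (fun z => Num.max (Imi z) 0) (fun z => hmax _ _ (Im_le_cmod z)).
have [s4 h4] := part (fun z => Num.max (- Imi z) 0)
  (fun z => hmax _ _ (eq_ind_r (fun x => x <= _) (Im_le_cmod z) (normrN _))).
have := sums_add (sums_sub h1 h2) (sums_scale (Complex 0 1) (sums_sub h3 h4)).
have maxB (x : R) : Num.max x 0 - Num.max (- x) 0 = x.
  rewrite /Num.max /Order.max; case: ltgtP => x0; case: ltgtP => x1; try lra.
move=> h; exists (s1 - s2 + Complex 0 1 * (s3 - s4)); apply: sums_eq h => // i.
by rewrite -!rmorphB /= !maxB [RHS]complexE.
Qed.

Lemma sums_fin t (r : seq I) : uniq r -> (forall i, i \notin r -> t i = 0) ->
  abs_sums_to t (\sum_(i <- r) t i).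
Proof.
move=> ur t0; pose J0 := [fset i in r]%fset.
have E J (f : I -> R[i]) : (forall i, i \notin r -> f i = 0) -> (J0 `<=` J)%fset ->
    \sum_(i <- J) f i = \sum_(i <- r) f i.
  move=> f0 J0J; rewrite (big_fsetID _ (mem r)) /= [X in _ + X]big1_seq ?addr0; last first.
    by move=> i /andP[_]; rewrite !inE /= => /andP[_ /f0].
  apply: perm_big; apply: uniq_perm => // i; rewrite !inE /= andbC.
  case: (boolP (i \in r)) => //= ir; rewrite (fsubsetP J0J) //.
  by rewrite !inE.
split=> [|e e0]; last by exists J0 => J /(E _ _ t0) ->; rewrite subrr cmod0.
apply/abs_summableP; exists (\sum_(i <- r) cmod (t i)) => J.
apply: le_trans (@fset_sum_le (fun i => cmod (t i)) J (J `|` J0)%fset _ _) _ => //.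
- by move=> i; exact: cmod_ge0.
- exact: fsubsetUl.
have := E (J `|` J0)%fset (fun i => (cmod (t i))%:C).
rewrite -!rmorph_sum => /(_ _ _)/complexI -> //; last exact: fsubsetUr.
by move=> i /t0 ->; rewrite cmod0.
Qed.

Lemma sums0 : abs_sums_to (fun _ : I => 0 : R[i]) 0.
Proof. by have := @sums_fin (fun=> 0) [::]; rewrite big_nil; apply. Qed.

Lemma sums_bigsum (T : Type) (r : seq T) (t : T -> I -> R[i]) (s : T -> R[i]) :
  (forall x, abs_sums_to (t x) (s x)) ->
  abs_sums_to (fun i => \sum_(x <- r) t x i) (\sum_(x <- r) s x).
Proof.
move=> h; elim: r => [|x r IH].
  by apply: sums_eq sums0 => [i|]; rewrite big_nil.
by apply: sums_eq (sums_add (h x) IH) => [i|]; rewrite big_cons.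
Qed.

End OneIndex.

Lemma sums_reindex (I I' : choiceType) (f : I -> I') (f' : I' -> I) (t : I' -> R[i]) s :
  cancel f f' -> cancel f' f -> abs_sums_to t s ->
  abs_sums_to (fun i => t (f i)) s.
Proof.
move=> fK f'K [/abs_summableP[M hM] ht].
have E (V : nmodType) (J : {fset I}) (a : I' -> V) :
    \sum_(i <- J) a (f i) = \sum_(i <- [fset f i | i in J]%fset) a i.
  rewrite big_imfset //=; exact: in2W (can_inj fK).
split.
  apply/abs_summableP; exists M => J; rewrite (E _ J (fun i => cmod (t i))); exact: hM.
move=> e /ht[J0 h0]; exists [fset f' i | i in J0]%fset => J J0J.
rewrite E; apply: h0; apply/fsubsetP => i iJ0; apply/imfsetP; exists (f' i) => //=.
by apply: (fsubsetP J0J); apply/imfsetP; exists i.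
Qed.

End Summation.

(** * Exponential polynomials *)

Section ExponentialPolynomials.
Variable R : realType.
Local Notation "x %:C" := (real_complex R x).
Local Notation Rei := (@complex.Re R).
Implicit Types (q : {poly R[i]}).

(** By [1 + t <= e^t] at [t = d y / (K + 1)], the exponential [e^(d y)] exceeds a
  multiple of [(1 + y)^(K + 1)]. *)
Lemma expR_beats_poly (c C0 y0 d : R) (K : nat) : 0 < d -> 0 <= c ->
  (forall y, y0 <= y -> c <= C0 * (1 + `|y|) ^+ K * expR (- (d * y))) -> c = 0.
Proof.
move=> d0 c0 H; apply/eqP; rewrite eq_le c0 andbT leNgt; apply/negP => c1.
pose g := Num.min 1 (d / K.+1%:R).
have g0 : 0 < g by rewrite lt_min ltr01 divr_gt0.
have g1 : g <= 1 by rewrite ge_min lexx.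
have g2 : g <= d / K.+1%:R by rewrite ge_min lexx orbT.
have C0ge : 0 <= C0.
  rewrite leNgt; apply/negP => Cn; have := H y0 (lexx _); apply/negP; rewrite -ltNge.
  apply: le_lt_trans c1; rewrite -mulrA; apply: mulr_le0_ge0 (ltW Cn) _.
  by rewrite mulr_ge0 ?expR_ge0 // exprn_ge0 // addr_ge0.
pose y := Num.max (Num.max y0 0) (C0 / (c * g ^+ K.+1)).
have ly0 : y0 <= y by rewrite /y !le_max lexx.
have y1 : 0 <= y by rewrite /y !le_max lexx orbT.
have y2 : C0 / (c * g ^+ K.+1) <= y by rewrite /y !le_max lexx orbT.
have big : (g * (1 + y)) ^+ K.+1 <= expR (d * y).
  have -> : d * y = K.+1%:R * (d * y / K.+1%:R) by rewrite [RHS]mulrC divfK // pnatr_eq0.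
  rewrite expRM_natl lerXn2r ?nnegrE ?expR_ge0 //; first by rewrite mulr_ge0 ?ltW // ltr_wpDr.
  apply: le_trans (expR_ge1Dx _); rewrite mulrDr mulr1 lerD // mulrAC.
  by rewrite ler_wpM2r.
have := H y ly0; rewrite expRN ger0_norm // ler_pdivlMr ?expR_gt0 // => le1.
have {}le1 := le_trans (ler_wpM2l (ltW c1) big) le1.
have y3 : 0 < 1 + y by rewrite ltr_wpDr.
move: le1; rewrite exprMn [(1 + y) ^+ K.+1]exprS mulrA mulrA ler_pM2r ?exprn_gt0 //.
apply/negP; rewrite -ltNge; rewrite ler_pdivrMr in y2; last by rewrite mulr_gt0 ?exprn_gt0.
apply: le_lt_trans y2 _; rewrite mulrC ltr_pM2l ?mulr_gt0 ?exprn_gt0 //.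
by rewrite ltrDr.
Qed.

(** A translation-invariant polynomial takes its value at [0] at all multiples of
  the period. *)
Lemma poly_shift_const q (h : R[i]) : h != 0 -> q \Po ('X - h%:P) = q ->
  (size q <= 1)%N.
Proof.
move=> h0 qE; rewrite leqNgt; apply/negP => sq.
have val m : q.[- (m%:R * h)] = q.[0].
  elim: m => [|m <-]; first by rewrite mul0r oppr0.
  rewrite -{2}qE horner_comp !hornerE; congr (q.[_]).
  by rewrite -natr1 mulrDl mul1r opprD.
have : q - (q.[0])%:P = 0.
  apply: (@roots_geq_poly_eq0 _ _ [seq - (m%:R * h) | m <- iota 0 (size q)]).
  - apply/allP => _ /mapP[m _ ->]; rewrite /root !hornerE val subrr //.
  - rewrite map_inj_uniq ?iota_uniq // => m n /oppr_inj /(mulIf h0) /eqP.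
    by rewrite eqr_nat => /eqP.
  - rewrite size_map size_iota size_polyDl // size_polyN.
    by apply: leq_ltn_trans sq; exact: size_polyC_leq1.
move/eqP; rewrite subr_eq0 => /eqP qc; move: sq; rewrite qc ltnNge.
by rewrite size_polyC_leq1.
Qed.

(** Applying [T_h - e^(-b h)], where [T_h] is translation by [h], preserves the
  growth condition, lowers the degree of the coefficient of [e^(b x)] and keeps
  the degrees of the others. *)
Definition diff_coef (b h : R[i]) (a : R[i]) q : {poly R[i]} :=
  cexp (- (a * h)) *: (q \Po ('X - h%:P)) - cexp (- (b * h)) *: q.

Lemma size_shift_poly q (h : R[i]) : size (q \Po ('X - h%:P)) = size q.
Proof. by rewrite size_comp_poly2 // size_XsubC. Qed.

Lemma size_diff_coef b h a q : (size (diff_coef b h a q) <= size q)%N.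
Proof.
apply: leq_trans (size_polyD _ _) _; rewrite size_polyN geq_max.
by rewrite !size_scale ?cexp_neq0 // size_shift_poly leqnn.
Qed.

Lemma lead_diff_coef b h a q : (diff_coef b h a q)`_(size q).-1 =
  (cexp (- (a * h)) - cexp (- (b * h))) * lead_coef q.
Proof.
rewrite coefB !coefZ mulrBl -lead_coefE; congr (_ * _ - _).
rewrite -(size_shift_poly q h) -lead_coefE lead_coef_comp ?size_XsubC //.
by rewrite lead_coefXsubC expr1n mulr1.
Qed.

Lemma size_diff_coef_lt b h q : q != 0 -> (size (diff_coef b h b q) < size q)%N.
Proof.
move=> q0; rewrite ltn_neqAle size_diff_coef andbT; apply/eqP => sE.
have := lead_diff_coef b h b q; rewrite subrr mul0r -sE -lead_coefE => /eqP.
rewrite lead_coef_eq0 => /eqP d0; move: sE; rewrite d0 size_poly0 => /esym/eqP.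
by rewrite size_poly_eq0; apply/negP.
Qed.

(** The moduli differ if the real parts of [a] and [b] do; otherwise the step is
  chosen to make the ratio of the two exponentials [-1]. *)
Lemma cexp_separate (a b : R[i]) : a != b ->
  exists2 h : R, 0 < h & cexp (- (a * h%:C)) != cexp (- (b * h%:C)).
Proof.
move=> ab; have [rE|rN] := eqVneq (Rei a) (Rei b); last first.
  exists 1 => //; apply: contra_neq rN => /(congr1 (@cmod R)).
  by rewrite !cmod_cexp !ReN !ReMr !mulr1 => /expR_inj/oppr_inj.
pose t := complex.Im a - complex.Im b.
have t0 : t != 0.
  apply: contra_neq ab => /eqP; rewrite subr_eq0 => /eqP.
  by case: (a) (b) rE => ? ? [? ?] /= -> ->.
exists (pi / `|t|); first by rewrite divr_gt0 ?pi_gt0 ?normr_gt0.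
apply/eqP => E; suff: cexp (- ((a - b) * (pi / `|t|)%:C)) = -1 :> R[i].
  rewrite mulrBl opprB addrC cexpD E -cexpD addNr cexp0.
  by move/eqP; rewrite -subr_eq0 opprK -mulr2n pnatr_eq0.
have -> : - ((a - b) * (pi / `|t|)%:C) = Complex 0 (- (Num.sg t * pi)).
  apply/eqP; rewrite eq_complex ReN ReMr ReD ReN rE subrr mul0r oppr0 eqxx /=.
  have -> : complex.Im (- ((a - b) * (pi / `|t|)%:C)) = - (t * (pi / `|t|)).
    rewrite /t; case: (a) (b) => ? ? [? ?] /=; ring.
  by rewrite mulrCA -{1}[t]mulr_sg_norm mulfK ?normr_eq0 // mulrC.
rewrite /cexp /= expR0 cosN sinN cos_sg // sin_sg cospi sinpi mulr0 oppr0 mulr0 mul1r.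
by apply/eqP; rewrite eq_complex /= oppr0 !eqxx.
Qed.

(** Induction on the total degree: a difference operator lowers the degree of one
  coefficient without killing another. What cannot be reduced is a single
  exponential with a constant coefficient, which outgrows the bound as [x] tends
  to minus infinity. *)
Lemma exp_poly_zero (r : seq R[i]) (q : R[i] -> {poly R[i]}) (b C0 x0 : R) K :
  uniq r -> (forall a, a \in r -> Rei a < b) ->
  (forall x, x <= x0 -> cmod (\sum_(a <- r) cexp (a * x%:C) * (q a).[x%:C]) <=
     C0 * (1 + `|x|) ^+ K * expR (b * x)) ->
  forall a, a \in r -> q a = 0.
Proof.
move=> ur rb; have [n le_n] := ubnP (\sum_(a <- r) size (q a))%N.
elim: n => // n IH in q C0 x0 le_n * => H a0 ra0; apply/eqP/negPn/negP => qa0.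
(* One difference step keeping the coefficient of a0 nonzero gives a
   contradiction with the induction hypothesis. *)
have step (a1 : R[i]) (h : R) : a1 \in r -> q a1 != 0 -> 0 < h ->
    diff_coef a1 h%:C a0 (q a0) != 0 -> False.
  move=> ra1 qa1 h0 /eqP; apply; pose q' a := diff_coef a1 h%:C a (q a).
  have C0ge : 0 <= C0.
    have := le_trans (cmod_ge0 _) (H x0 (lexx _)).
    by rewrite pmulr_lge0 ?expR_gt0 // pmulr_lge0 // exprn_gt0 // ltr_wpDr.
  apply: (IH q' (C0 * ((1 + h) ^+ K * expR (- (b * h)) + cmod (cexp (- (a1 * h%:C)))))
            x0) => //.
    rewrite -ltnS; apply: leq_trans le_n; rewrite ltnS (bigD1_seq a1) //= [X in (_ < X)%N](bigD1_seq a1) //=.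
    by rewrite -addSn leq_add ?size_diff_coef_lt // leq_sum // => *; exact: size_diff_coef.
  move=> x xx0; have xh : x - h <= x0 by rewrite lerBlDr (le_trans xx0) // lerDl ltW.
  have -> : \sum_(a <- r) cexp (a * x%:C) * (q' a).[x%:C] =
     \sum_(a <- r) cexp (a * (x - h)%:C) * (q a).[(x - h)%:C] -
     cexp (- (a1 * h%:C)) * \sum_(a <- r) cexp (a * x%:C) * (q a).[x%:C].
    rewrite mulr_sumr -sumrB; apply: eq_bigr => a _.
    rewrite /q' /diff_coef !hornerE horner_comp !hornerE rmorphB mulrBr [a * (_ - _)]mulrBr cexpD.
    by rewrite mulrA; congr (_ - _); rewrite mulrCA mulrA.
  apply: le_trans (cmodD _ _) _; rewrite cmodN cmodM mulrDr !mulrDl lerD //; last first.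
    rewrite -!mulrA mulrCA ler_wpM2l ?cmod_ge0 // !mulrA; exact: H.
  apply: le_trans (H _ xh) _; rewrite mulrBr expRD -!mulrA ler_wpM2l //.
  rewrite [leRHS](_ : _ = ((1 + h) * (1 + `|x|)) ^+ K * (expR (b * x) * expR (- (b * h)))).
    rewrite ler_wpM2r ?mulr_ge0 ?expR_ge0 // lerXn2r ?nnegrE ?mulr_ge0 ?addr_ge0 ?(ltW h0) //.
    have := ler_normB x h; rewrite (gtr0_norm h0).
    by have := mulr_ge0 (ltW h0) (normr_ge0 x); lra.
  by rewrite exprMn; ring.
have [[a1 /and3P[ra1 a10 qa1]]|none] := pselect (exists a, [&& a \in r, a != a0 & q a != 0]).
  have [h h0 hsep] := cexp_separate a10.
  apply: (step a1 h ra1 qa1 h0); apply/eqP => d0.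
  have := lead_diff_coef a1 h%:C a0 (q a0); rewrite d0 coef0 => /esym/eqP.
  by rewrite mulf_eq0 lead_coef_eq0 (negbTE qa0) orbF subr_eq0 eq_sym (negbTE hsep).
have [s1|s2] := leqP (size (q a0)) 1; last first.
  apply: (step a0 1 ra0 qa0 ltr01); rewrite /diff_coef -scalerBr scaler_eq0.
  rewrite (negbTE (cexp_neq0 _)) subr_eq0 /=; apply/eqP => /poly_shift_const.
  by rewrite leqNgt s2 => /(_ _)/notF; apply; rewrite oner_eq0.
have cE := size1_polyC s1; set c := (q a0)`_0 in cE.
have c0 : cmod c = 0.
  apply: (@expR_beats_poly _ C0 (- x0) (b - Rei a0) K); rewrite ?subr_gt0 ?rb ?cmod_ge0 //.
  move=> y yx; have := H (- y); rewrite lerNl => /(_ yx).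
  rewrite (bigD1_seq a0) //= big1_seq ?addr0; last first.
    move=> a /andP[aa0 ra]; suff -> : q a = 0 by rewrite horner0 mulr0.
    by apply/eqP/negPn/negP => qa; apply: none; exists a; rewrite ra aa0.
  rewrite cE hornerC cmodM cmod_cexp normrN ReMr -ler_pdivlMl ?expR_gt0 // => /le_trans; apply.
  rewrite mulrC -expRN -!mulrA -expRD.
  rewrite (_ : b * - y + - (Rei a0 * - y) = - ((b - Rei a0) * y)) //; ring.
by move/eqP: c0; rewrite cmod_eq0 => /eqP c0; move: qa0; rewrite cE c0 eqxx.
Qed.

End ExponentialPolynomials.

(** * Uniqueness of expansions *)

Section UniqueExpansion.
Variable R : realType.
Local Notation "x %:C" := (real_complex R x).
Local Notation Rei := (@complex.Re R).
Local Notation exps := (R[i] * nat)%type.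

(** The monomial [z^n (log z)^q] at the positive real [z = e^x], for the branch
  of the logarithm that is real there. *)
Definition emono (x : R) (d : exps) : R[i] := mono 0 (expR x)%:C d.

Lemma emonoE x d : emono x d = cexp (d.1 * x%:C) * x%:C ^+ d.2.
Proof. by rewrite /emono /mono lp0_exp. Qed.

Lemma emono_neq0 x d : x != 0 -> emono x d != 0.
Proof.
move=> x0; rewrite emonoE mulf_neq0 ?cexp_neq0 // expf_neq0 //.
by rewrite -(rmorph0 (real_complex R)) (inj_eq (@complexI R)).
Qed.

(** A series with arbitrary complex exponents may converge absolutely to [0] on an
  interval without vanishing term by term; finitely many progressions [a + N] and
  bounded powers of the logarithm exclude this. *)
Definition in_progressions (A : seq R[i]) (K : nat) (d : exps) : Prop :=
  (d.2 < K)%N /\ exists2 a, a \in A & exists m : nat, d.1 = a + m%:R.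

(** The finitely many exponents of real part below [b] form, after grouping, an
  exponential polynomial equal to minus the tail, which is of order [e^(b x)]. *)
Lemma one_variable_unique (I : choiceType) (t : I -> R[i]) (pi : I -> exps)
    (x0 : R) A K :
  (forall d, t d != 0 -> in_progressions A K (pi d)) ->
  (forall x, x <= x0 -> abs_sums_to (fun d => t d * emono x (pi d)) 0) ->
  forall e, abs_sums_to (fun d => if pi d == e then t d else 0) 0.
Proof.
move=> tA ht e; have [x1 x1x0 x1N] : exists2 x1 : R, x1 <= x0 & x1 <= -1.
  by exists (Num.min x0 (-1)); rewrite ge_min lexx ?orbT.
have x1n0 : x1 != 0 by rewrite lt_eqF // (le_lt_trans x1N).
pose tE e' d := if pi d == e' then t d else 0.
have /choice[S hS] : forall e', exists s, abs_sums_to (tE e') s.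
  move=> e'; apply: sums_exist; have [st _] := ht x1 x1x0.
  apply: (summable_le (C := (cmod (emono x1 e'))^-1)) st => [|d].
    by rewrite invr_ge0 cmod_ge0.
  rewrite /tE; case: eqP => [<-|_].
    by rewrite cmodM mulrCA mulVf ?mulr1 // cmod_eq0 emono_neq0.
  by rewrite cmod0 mulr_ge0 ?invr_ge0 ?cmod_ge0.
pose b := Rei e.1 + 1.
pose M0 := (\max_(a <- A) (Num.truncn (b - Rei a)).+1)%N.
have hM0 a : a \in A -> b <= Rei a + M0%:R.
  move=> aA; rewrite -lerBlDl; apply: le_trans (ltW (truncnS_gt _)) _.
  by rewrite ler_nat /M0 (big_rem a) //= leq_maxl.
pose r := [seq n <- undup [seq a + m%:R | a <- A, m <- iota 0 M0] | Rei n < b].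
have ur : uniq r by rewrite filter_uniq // undup_uniq.
have rb n : n \in r -> Rei n < b by rewrite mem_filter => /andP[].
have inr d : t d != 0 -> Rei (pi d).1 < b -> (pi d).1 \in r.
  move=> /tA[_ [a aA [m dE]]] db; rewrite mem_filter db mem_undup /= dE.
  apply/allpairsP; exists (a, m); split => //=; rewrite mem_iota /= add0n.
  rewrite -(ltr_nat R) -(ltrD2l (Rei a)); apply: lt_le_trans (hM0 _ aA).
  by move: db; rewrite dE ReD Re_nat.
pose tail d := if b <= Rei (pi d).1 then t d else 0.
have decomp x d : tail d * emono x (pi d) = t d * emono x (pi d) -
    \sum_(n <- r) \sum_(q < K) emono x (n, q : nat) * tE (n, q : nat) d.
  have [td0|td0] := eqVneq (t d) 0.
    rewrite /tail /tE td0 if_same !mul0r big1 ?subr0 // => n _.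
    by rewrite big1 // => q _; rewrite if_same mulr0.
  rewrite /tail; case: leP => [bd|db].
    rewrite big1_seq ?subr0 // => n /andP[_ /rb nb]; rewrite big1 // => q _.
    by rewrite /tE; case: eqP => [dE|]; rewrite ?mulr0 //; move: bd; rewrite dE leNgt nb.
  have [qK _] := tA _ td0.
  rewrite (bigD1_seq _ (inr _ td0 db) ur) //= (bigD1 (Ordinal qK)) //= /tE -surjective_pairing.
  rewrite eqxx mul0r [X in _ + X + _]big1 ?addr0 => [|q qE]; last first.
    case: eqP => [dE|]; rewrite ?mulr0 //; case/eqP: qE; apply: val_inj.
    by rewrite /= dE.
  rewrite [X in _ - (_ + X)]big1 ?addr0 => [|n nE]; first by rewrite mulrC subrr.
  rewrite big1 // => q _; case: eqP => [dE|]; rewrite ?mulr0 //.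
  by rewrite dE eqxx in nE.
have tail_sum x : x <= x0 -> abs_sums_to (fun d => tail d * emono x (pi d))
    (- \sum_(n <- r) \sum_(q < K) emono x (n, q : nat) * S (n, q : nat)).
  move=> xx0; rewrite -[X in abs_sums_to _ X]add0r; under eq_fun do rewrite decomp.
  apply: sums_sub (ht _ xx0) _; apply: sums_bigsum => n; apply: sums_bigsum => q.
  exact: sums_scale.
have [/abs_summableP[M hM] _] := ht x1 x1x0.
have growth x d : x <= x1 -> b <= Rei d.1 -> (d.2 <= K)%N ->
    cmod (emono x d) <= expR (b * (x - x1)) * (1 + `|x|) ^+ K * cmod (emono x1 d).
  move=> xx1 bd dK; rewrite !emonoE !cmodM !cmod_cexp !ReMr !cmodX !cmodC.
  have -> : Rei d.1 * x = Rei d.1 * (x - x1) + Rei d.1 * x1 by ring.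
  rewrite expRD -!mulrA ler_pM ?mulr_ge0 ?expR_ge0 ?exprn_ge0 //.
    by rewrite ler_expR ler_wnM2r // subr_le0.
  rewrite mulrCA ler_wpM2l ?expR_ge0 //.
  have x1n1 : 1 <= `|x1|.
    by rewrite ler0_norm; [rewrite lerNr|apply: le_trans x1N _; rewrite lerN10].
  rewrite -[leLHS]mulr1 ler_pM ?exprn_ge0 ?ler01 ?exprn_ege1 //.
  apply: (@le_trans _ _ ((1 + `|x|) ^+ d.2)).
    by rewrite lerXn2r ?nnegrE ?addr_ge0 // lerDr.
  by rewrite ler_weXn2l // lerDl.
have S0 n : n \in r -> \poly_(q < K) S (n, q) = 0.
  apply: (exp_poly_zero (q := fun n => \poly_(q < K) S (n, q)) (b := b) (C0 := M * expR (- (b * x1))) (x0 := x1) (K := K)) => //.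
  move=> x xx1; rewrite -cmodN.
  have -> : - (\sum_(a <- r) cexp (a * x%:C) * (\poly_(q < K) S (a, q)).[x%:C]) =
     - (\sum_(n <- r) \sum_(q < K) emono x (n, q : nat) * S (n, q : nat)).
    congr (- _); apply: eq_bigr => a _; rewrite horner_poly mulr_sumr.
    by apply: eq_bigr => q _; rewrite emonoE /= -mulrA [S _ * _]mulrC.
  apply: sums_bound (tail_sum x (le_trans xx1 x1x0)) => J.
  apply: (@le_trans _ _ (\sum_(d <- J) expR (b * (x - x1)) * (1 + `|x|) ^+ K *
      cmod (t d * emono x1 (pi d)))).
    apply: ler_sum => d _; rewrite [leLHS]cmodM [cmod (t d * _)]cmodM [leRHS]mulrCA /tail.
    case: (leP b) => [bd|_]; last first.
      by rewrite cmod0 mul0r !mulr_ge0 ?expR_ge0 ?exprn_ge0 ?addr_ge0 ?cmod_ge0.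
    have [->|td0] := eqVneq (t d) 0; first by rewrite cmod0 !mul0r.
    have [qK _] := tA _ td0.
    apply: ler_wpM2l; first exact: cmod_ge0.
    by apply: growth => //; exact: ltnW.
  rewrite -mulr_sumr; apply: (@le_trans _ _ (expR (b * (x - x1)) * (1 + `|x|) ^+ K * M)).
    by rewrite ler_wpM2l // mulr_ge0 ?expR_ge0 // exprn_ge0 // addr_ge0.
  rewrite mulrBr expRD le_eqVlt; apply/orP; left; apply/eqP; ring.
have [/andP[er eK]|eN] := boolP ((e.1 \in r) && (e.2 < K)%N).
  have Se : S e = 0.
    have := congr1 (fun p : {poly _} => p`_e.2) (S0 _ er).
    by rewrite coef_poly eK coef0 -surjective_pairing.
  by have := hS e; rewrite Se.
apply: sums_eq (sums0 _ I) => // d; case: eqP => // dE.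
apply/esym/eqP/negPn/negP => td0; case/negP: eN; rewrite -dE.
have [-> _] := tA _ td0; rewrite inr //= dE /b ltrDl //.
Qed.

(** The support condition is imposed one variable at a time, with the later
  exponents fixed: in a product of vertex operators neither the progressions nor
  the bound on the powers of the logarithm is uniform in the later exponents. *)
Definition hsupp (I : choiceType) (k : nat) (pr : 'I_k -> I -> exps) (c : I -> R[i]) : Prop :=
  forall (j : 'I_k) (e : I), exists A K, forall d,
    (forall i : 'I_k, (j < i)%N -> pr i d = pr i e) -> c d != 0 ->
    in_progressions A K (pr j d).

(** The variables are removed from the last to the first: with the others fixed,
  the last one may tend to [0], and the series in that variable alone has only
  zero coefficients. *)
Lemma series_unique (I : choiceType) (k : nat) (pr : 'I_k -> I -> exps) (c : I -> R[i]) :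
  (forall d d', (forall j, pr j d = pr j d') -> d = d') -> hsupp pr c ->
  (forall x : 'I_k -> R, (forall i j : 'I_k, (i < j)%N -> x j < x i) ->
     abs_sums_to (fun d => c d * \prod_j emono (x j) (pr j d)) 0) ->
  forall d, c d = 0.
Proof.
move=> inj_pr cA hc.
pose P (j : nat) := forall (e : I) (x : 'I_k -> R),
  (forall i j : 'I_k, (i < j)%N -> x j < x i) ->
  abs_sums_to (fun d => if [forall i : 'I_k, (j <= i)%N ==> (pr i d == pr i e)]
    then c d * \prod_(i < k | (i < j)%N) emono (x i) (pr i d) else 0) 0.
have Pk : P k.
  move=> e x hx; apply: sums_eq (hc x hx) => // d.
  rewrite (_ : [forall i, _]) => [|]; last by apply/forallP => i; rewrite leqNgt ltn_ord.
  by congr (_ * _); apply: eq_bigl => i; rewrite ltn_ord.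
have PS j : (j < k)%N -> P j.+1 -> P j.
  move=> jk PSj e x hx; pose jo := Ordinal jk.
  have [A [K AK]] := cA jo e.
  pose t d := if [forall i : 'I_k, (j < i)%N ==> (pr i d == pr i e)]
    then c d * \prod_(i < k | (i < j)%N) emono (x i) (pr i d) else 0.
  have tA d : t d != 0 -> in_progressions A K (pr jo d).
    rewrite /t; case: ifP => [/forallP h|_]; last by rewrite eqxx.
    rewrite mulf_eq0 => /norP[cd _]; apply: AK cd => i ji.
    by apply/eqP/(implyP (h i)).
  (* The later variables are lowered together with the current one, to stay in the
     region; their exponents being fixed, they do not occur in the sum. *)
  have ht y : y <= x jo -> abs_sums_to (fun d => t d * emono y (pr jo d)) 0.
    move=> yx; pose x' (i : 'I_k) := if (i < j)%N then x i else x i + (y - x jo).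
    have hx' (i i' : 'I_k) : (i < i')%N -> x' i' < x' i.
      move=> ii; have := hx _ _ ii; rewrite /x'.
      by case: ifP => h1; case: ifP => h2; [lra|exfalso; lia|lra|lra].
    apply: sums_eq (PSj e x' hx') => [d|]; last by [].
    have prodE : \prod_(i < k | (i < j.+1)%N) emono (x' i) (pr i d) =
        emono y (pr jo d) * \prod_(i < k | (i < j)%N) emono (x i) (pr i d).
      have -> : y = x' jo by rewrite /x' /= ltnn addrC subrK.
      rewrite (bigD1 jo (ltnSn j)); congr (_ * _); apply: eq_big => [i|i].
        by rewrite ltnS andbC -(inj_eq val_inj) /= -ltn_neqAle.
      by rewrite /x' ltnS andbC -(inj_eq val_inj) /= -ltn_neqAle => ->.
    rewrite prodE /t; case: (boolP [forall i : 'I_k, (j < i)%N ==> _]) => _.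
      by rewrite -mulrA [X in c d * X]mulrC.
    by rewrite mul0r.
  apply: sums_eq (one_variable_unique tA ht (pr jo e)) => // d.
  rewrite /t; case: (eqVneq (pr jo d) (pr jo e)) => [jE|jN].
    congr (if _ then _ else _); apply/forallP/forallP => h i.
      apply/implyP; rewrite leq_eqVlt => /orP[/eqP jiE|ji]; last exact: (implyP (h i)).
      by rewrite (_ : i = jo) ?jE //; apply: val_inj.
    by apply/implyP => /ltnW; apply/implyP.
  by case: ifP => // /forallP/(_ jo); rewrite /= leqnn /= (negbTE jN).
have P0 : P 0%N.
  suff H m : (m <= k)%N -> P (k - m)%N by rewrite -(subnn k); exact: H.
  elim: m => [|m IH] mk; first by rewrite subn0.
  apply: PS; first by rewrite ltn_subrL (leq_ltn_trans _ mk).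
  by rewrite subnSK //; apply: IH; exact: ltnW.
move=> d; pose x (i : 'I_k) : R := - (i : nat)%:R.
have hx (i j : 'I_k) : (i < j)%N -> x j < x i by rewrite ltrN2 ltr_nat.
have := P0 d x hx; set f := (fun _ => _) => hf.
have f0 i : i \notin [:: d] -> f i = 0.
  rewrite inE /f => id; case: ifP => // /forallP h; case/eqP: id.
  by apply: inj_pr => j; apply/eqP; exact: h.
have := sums_fin (isT : uniq [:: d]) f0; rewrite big_seq1 => /(sums_uniq hf)/esym.
rewrite /f (_ : [forall i, _]) => [|]; first by rewrite big_pred0 ?mulr1.
by apply/forallP => i; rewrite eqxx.
Qed.

End UniqueExpansion.

(** * Formal multiplication by differences of variables *)

Section FormalSeries.
Variable R : realType.
Local Notation "x %:C" := (real_complex R x).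
Local Notation Rei := (@complex.Re R).
Local Notation exps := (R[i] * nat)%type.

Section OneIndex.
Variable I : choiceType.
Implicit Types (a b c u : I -> R[i]) (L : seq (R[i] * I)).

(** Finite formal sums are lists of terms in which an index may occur repeatedly, so
  that sums, multiples and shifts are operations on lists. *)
Definition fcoef L (d : I) : R[i] := \sum_(l <- L | l.2 == d) l.1.

Definition feval L (u : I -> R[i]) : R[i] := \sum_(l <- L) l.1 * u l.2.

Lemma feval_sums L u : abs_sums_to (fun d => fcoef L d * u d) (feval L u).
Proof.
apply: (@sums_eq _ _ (fun d => \sum_(l <- L) if l.2 == d then l.1 * u l.2 else 0)) => //.
  move=> d; rewrite /fcoef mulr_suml -big_mkcond /=.
  by apply: eq_bigr => l /eqP ->.
apply: sums_bigsum => -[x d0] /=.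
have := @sums_fin _ _ (fun d => if d0 == d then x * u d0 else 0) [:: d0] isT.
rewrite big_seq1 eqxx; apply => d; rewrite inE eq_sym; by case: eqP.
Qed.

Lemma feval_eq L L' u : fcoef L =1 fcoef L' -> feval L u = feval L' u.
Proof.
move=> E; apply: sums_uniq (feval_sums L u) _.
by apply: sums_eq (feval_sums L' u) => // d; rewrite E.
Qed.

Definition fscale (x : R[i]) L := [seq (x * l.1, l.2) | l <- L].

Lemma fcoef_scale x L d : fcoef (fscale x L) d = x * fcoef L d.
Proof. by rewrite /fcoef big_map mulr_sumr. Qed.

Lemma feval_scale x L u : feval (fscale x L) u = x * feval L u.
Proof. by rewrite /feval big_map mulr_sumr; apply: eq_bigr => l _; rewrite mulrA. Qed.

Lemma feval_cat L L' u : feval (L ++ L') u = feval L u + feval L' u.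
Proof. exact: big_cat. Qed.

(** When [S1] and [S2] lower the exponents of [z1] and [z2] by one, this is
  multiplication of the series by [z1 - z2]. *)
Definition diff_op (S1 S2 : I -> I) a (d : I) : R[i] := a (S1 d) - a (S2 d).

Lemma diff_op_sums (S1 S2 S1' S2' : I -> I) (z1 z2 : R[i]) a u s :
  cancel S1 S1' -> cancel S1' S1 -> cancel S2 S2' -> cancel S2' S2 ->
  (forall d, u d = z1 * u (S1 d)) -> (forall d, u d = z2 * u (S2 d)) ->
  abs_sums_to (fun d => a d * u d) s ->
  abs_sums_to (fun d => diff_op S1 S2 a d * u d) ((z1 - z2) * s).
Proof.
move=> K1 K1' K2 K2' u1 u2 h; rewrite mulrBl.
have h1 := sums_scale z1 (sums_reindex K1 K1' h).
have h2 := sums_scale z2 (sums_reindex K2 K2' h).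
apply: sums_eq (sums_sub h1 h2) => // d.
by rewrite /diff_op mulrBl; congr (_ - _); rewrite mulrCA -?u1 -?u2.
Qed.

Section Support.
Variables (k : nat) (pr : 'I_k -> I -> exps).

Lemma in_progressions_sub A A' K K' (d : exps) : {subset A <= A'} -> (K <= K')%N ->
  in_progressions A K d -> in_progressions A' K' d.
Proof.
move=> AA KK [dK [a aA dE]]; split; first exact: leq_trans KK.
by exists a => //; exact: AA.
Qed.

Lemma hsupp_sub a b : hsupp pr a -> hsupp pr b -> hsupp pr (fun d => a d - b d).
Proof.
move=> ha hb j e; have [A [K hA]] := ha j e; have [A' [K' hA']] := hb j e.
exists (A ++ A'), (K + K')%N => d de; have [a0|a0 _] := eqVneq (a d) 0.
  rewrite a0 sub0r oppr_eq0 => /(hA' _ de); apply: in_progressions_sub (leq_addl _ _).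
  by move=> x xA; rewrite mem_cat xA orbT.
apply: in_progressions_sub (leq_addr _ _) (hA _ de a0) => x xA.
by rewrite mem_cat xA.
Qed.

Lemma hsupp_scale x a : hsupp pr a -> hsupp pr (fun d => x * a d).
Proof.
move=> ha j e; have [A [K hA]] := ha j e; exists A, K => d de.
by rewrite mulf_eq0 => /norP[_]; exact: hA.
Qed.

Lemma hsupp_shift (S : I -> I) (v : 'I_k -> R[i]) a :
  (forall i d, pr i (S d) = ((pr i d).1 - v i, (pr i d).2)) ->
  hsupp pr a -> hsupp pr (fun d => a (S d)).
Proof.
move=> prS ha j e; have [A [K hA]] := ha j (S e).
exists [seq x + v j | x <- A], K => d de /hA[] => [i ji|]; first by rewrite !prS de.
rewrite prS /= => dK [x xA [m dE]]; split=> //; exists (x + v j); first exact: map_f.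
by exists m; rewrite addrAC -dE subrK.
Qed.

Lemma hsupp_diff (S1 S2 : I -> I) (v1 v2 : 'I_k -> R[i]) a :
  (forall i d, pr i (S1 d) = ((pr i d).1 - v1 i, (pr i d).2)) ->
  (forall i d, pr i (S2 d) = ((pr i d).1 - v2 i, (pr i d).2)) ->
  hsupp pr a -> hsupp pr (diff_op S1 S2 a).
Proof.
move=> h1 h2 ha; apply: hsupp_sub; [exact: hsupp_shift h1 ha|exact: hsupp_shift h2 ha].
Qed.

Lemma hsupp_fcoef L : hsupp pr (fcoef L).
Proof.
move=> j e; exists [seq (pr j l.2).1 | l <- L], (\max_(l <- L) (pr j l.2).2).+1%N.
move=> d _ cd; have [l lL ld] : exists2 l, l \in L & l.2 == d.
  apply/hasP; apply: contraNT cd => /hasPn h; rewrite /fcoef big1_seq // => l /andP[ld lL].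
  by case/negP: (h _ lL).
rewrite -(eqP ld); split; first by rewrite ltnS (big_rem l) //= leq_maxl.
by exists (pr j l.2).1; [exact: map_f|exists 0%N; rewrite addr0].
Qed.

End Support.
End OneIndex.

Lemma mono_pred p (z : R[i]) (d : exps) : z != 0 ->
  mono p z d = z * mono p z (d.1 - 1, d.2).
Proof.
move=> z0; rewrite /mono /= mulrA; congr (_ * _).
by rewrite mulrBl mul1r cexpD cexpN cexp_lp // mulrCA divff ?mulr1.
Qed.

Definition exp_dn (d : exps) : exps := (d.1 - 1, d.2).
Definition exp_up (d : exps) : exps := (d.1 + 1, d.2).

Lemma exp_dnK : cancel exp_dn exp_up.
Proof. by case=> n q; rewrite /exp_up /exp_dn /= subrK. Qed.

Lemma exp_upK : cancel exp_up exp_dn.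
Proof. by case=> n q; rewrite /exp_up /exp_dn /= addrK. Qed.

Definition pair_dn1 (d : exps * exps) := (exp_dn d.1, d.2).
Definition pair_dn2 (d : exps * exps) := (d.1, exp_dn d.2).
Definition pair_mul := diff_op pair_dn1 pair_dn2.

Section SeveralVariables.
Variable k : nat.
Local Notation idx := {ffun 'I_k -> exps}.
Implicit Types (c a b : idx -> R[i]) (d e : idx) (i j : 'I_k).

Definition idx_dn i d : idx := [ffun l => if l == i then exp_dn (d l) else d l].
Definition idx_up i d : idx := [ffun l => if l == i then exp_up (d l) else d l].

Lemma idx_dnK i : cancel (idx_dn i) (idx_up i).
Proof. by move=> d; apply/ffunP => l; rewrite !ffunE; case: eqP; rewrite ?exp_dnK. Qed.

Lemma idx_upK i : cancel (idx_up i) (idx_dn i).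
Proof. by move=> d; apply/ffunP => l; rewrite !ffunE; case: eqP; rewrite ?exp_upK. Qed.

Lemma idx_dnC i j d : idx_dn i (idx_dn j d) = idx_dn j (idx_dn i d).
Proof. by apply/ffunP => l; rewrite !ffunE; case: eqP; case: eqP. Qed.

Definition mul_diff i j := diff_op (idx_dn i) (idx_dn j).

Definition mul_diffs (ps : seq ('I_k * 'I_k)) c :=
  foldr (fun ij b => mul_diff ij.1 ij.2 b) c ps.

Definition monos p (z : 'I_k -> R[i]) d : R[i] := \prod_i mono p (z i) (d i).

Lemma monos_dn p z i d : (forall l, z l != 0) ->
  monos p z d = z i * monos p z (idx_dn i d).
Proof.
move=> z0; rewrite /monos (bigD1 i) //= [X in _ = _ * X](bigD1 i) //= mulrA.
congr (_ * _); first by rewrite ffunE eqxx -mono_pred.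
by apply: eq_bigr => l /negbTE li; rewrite ffunE li.
Qed.

Definition diffs (ps : seq ('I_k * 'I_k)) (z : 'I_k -> R[i]) : R[i] :=
  \prod_(ij <- ps) (z ij.1 - z ij.2).

Lemma mul_diffs_sums p z ps c s : (forall l, z l != 0) ->
  abs_sums_to (fun d => c d * monos p z d) s ->
  abs_sums_to (fun d => mul_diffs ps c d * monos p z d) (diffs ps z * s).
Proof.
move=> z0 h; rewrite /diffs; elim: ps => [|[i j] ps IH] /=.
  by rewrite big_nil mul1r.
rewrite big_cons -mulrA; apply: diff_op_sums IH.
- exact: idx_dnK.
- exact: idx_upK.
- exact: idx_dnK.
- exact: idx_upK.
- by move=> d; exact: monos_dn.
- by move=> d; exact: monos_dn.
Qed.

Lemma mul_diffsB ps a b x d :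
  mul_diffs ps (fun d => a d - x * b d) d = mul_diffs ps a d - x * mul_diffs ps b d.
Proof.
elim: ps d => //= -[i j] ps IH d; rewrite /mul_diff /diff_op /= !IH.
ring.
Qed.

Lemma hsupp_mul_diffs (s : 'S_k) ps c : hsupp (fun j d => d (s j)) c ->
  hsupp (fun j d => d (s j)) (mul_diffs ps c).
Proof.
move=> hc; elim: ps => //= -[i j] ps IH /=.
have H (l : 'I_k) m (d : idx) : idx_dn l d (s m) = ((d (s m)).1 - (s m == l)%:R, (d (s m)).2).
  by rewrite ffunE; case: eqP; rewrite //= subr0 -surjective_pairing.
exact: hsupp_diff (H i) (H j) IH.
Qed.

Section Locality.
Variables i0 j0 : 'I_k.
Hypothesis ij0 : i0 != j0.

Definition same_fiber e d := forall l, l != i0 -> l != j0 -> d l = e l.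

(** Duality for a pair of operators gives this property to the difference of their
  two orders. The power of [z_(i0) - z_(j0)] depends on the other exponents,
  because the functional and the vector to which duality is applied do. *)
Definition local_null c := forall e, exists t, forall d, same_fiber e d ->
  iter t (mul_diff i0 j0) c d = 0.

Lemma same_fiber_dn l e d : same_fiber e d -> same_fiber (idx_dn l e) (idx_dn l d).
Proof. by move=> ed m m1 m2; rewrite !ffunE ed. Qed.

Lemma same_fiber_dn0 l e d : (l == i0) || (l == j0) -> same_fiber e d ->
  same_fiber e (idx_dn l d).
Proof.
move=> ll ed m m1 m2; rewrite ffunE -ed //; case: eqP => // ml.
by move: ll m1 m2; rewrite ml => /orP[] ->.
Qed.

Lemma local_null_le c e t t' : (t <= t')%N ->
  (forall d, same_fiber e d -> iter t (mul_diff i0 j0) c d = 0) ->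
  forall d, same_fiber e d -> iter t' (mul_diff i0 j0) c d = 0.
Proof.
move=> /subnK <-; elim: (t' - t)%N => // m IH H d ed; rewrite addSn /= /mul_diff /diff_op.
by rewrite !IH ?subrr //; apply: same_fiber_dn0 => //; rewrite eqxx ?orbT.
Qed.

Lemma mul_diffC i j i' j' c :
  mul_diff i j (mul_diff i' j' c) = mul_diff i' j' (mul_diff i j c).
Proof.
apply/funext => d; rewrite /mul_diff /diff_op !(idx_dnC i') !(idx_dnC j').
ring.
Qed.

Lemma iter_mul_diffC t i j c : iter t (mul_diff i0 j0) (mul_diff i j c) =
  mul_diff i j (iter t (mul_diff i0 j0) c).
Proof. by elim: t => //= t ->; rewrite mul_diffC. Qed.

Lemma local_null_mul_diff i j c : local_null c -> local_null (mul_diff i j c).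
Proof.
move=> hc e; have [t ht] := hc (idx_dn i e); have [t' ht'] := hc (idx_dn j e).
exists (maxn t t') => d ed; rewrite iter_mul_diffC /mul_diff /diff_op.
rewrite (local_null_le (leq_maxl t t') ht); last exact: same_fiber_dn.
rewrite (local_null_le (leq_maxr t t') ht') ?subrr //; exact: same_fiber_dn.
Qed.

Lemma local_null_mul_diffs ps c : local_null c -> local_null (mul_diffs ps c).
Proof. by move=> hc; elim: ps => //= ij ps; exact: local_null_mul_diff. Qed.

Definition slide d := idx_dn j0 (idx_up i0 d).

Definition eventually_zero c := forall d, exists m0, forall m, (m0 <= m)%N ->
  c (iter m slide d) = 0.

Lemma slide_fiber e d : same_fiber e d -> same_fiber e (slide d).
Proof. by move=> ed l l1 l2; rewrite !ffunE (negbTE l1) (negbTE l2) ed. Qed.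

Lemma slide_dn i d : slide (idx_dn i d) = idx_dn i (slide d).
Proof.
apply/ffunP => l; rewrite !ffunE; case: (l =P i0) => [->|_]; last by do 2!case: eqP.
rewrite (negbTE ij0); case: eqP => // _.
by rewrite exp_dnK exp_upK.
Qed.

Lemma eventually_zero_diff i j c : eventually_zero c -> eventually_zero (mul_diff i j c).
Proof.
move=> hc d; have [m1 h1] := hc (idx_dn i d); have [m2 h2] := hc (idx_dn j d).
have iterS m l : iter m slide (idx_dn l d) = idx_dn l (iter m slide d).
  by elim: m => //= m ->; rewrite slide_dn.
exists (maxn m1 m2) => m; rewrite geq_max => /andP[/h1 e1 /h2 e2].
by rewrite /mul_diff /diff_op -!iterS e1 e2 subrr.
Qed.

(** On a family vanishing far along each slide, [z_(i0) - z_(j0)] acts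
  injectively: its kernel consists of families constant along the slides. *)
Lemma local_eventually_zero c : local_null c -> eventually_zero c -> forall d, c d = 0.
Proof.
move=> hloc hc e; have [t ht] := hloc e.
suff: forall d, same_fiber e d -> c d = 0 by apply.
have {}hc : eventually_zero c by [].
elim: t c hloc hc ht => [|t IH] c hloc hc ht //.
have M0 := IH (mul_diff i0 j0 c) (local_null_mul_diff i0 j0 hloc)
  (eventually_zero_diff i0 j0 hc).
have {}M0 : forall d, same_fiber e d -> mul_diff i0 j0 c d = 0.
  by apply: M0 => d ed; rewrite -iterSr ht.
have slideE d : same_fiber e d -> c d = c (slide d).
  move=> ed; have ed' : same_fiber e (idx_up i0 d).
    by move=> l l1 l2; rewrite ffunE (negbTE l1) ed.
  by have /eqP := M0 _ ed'; rewrite /mul_diff /diff_op subr_eq0 idx_upK => /eqP.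
move=> d ed; have [m hm] := hc d; rewrite -(hm m (leqnn m)).
elim: m {hm} => //= m ->; apply: slideE.
by elim: m => //= m IHm; exact: slide_fiber.
Qed.

Lemma eventually_zero_fcoef L : eventually_zero (fcoef L).
Proof.
move=> d; exists (\max_(l <- L) (Num.truncn (Rei (l.2 i0).1 - Rei (d i0).1)).+1)%N => m hm.
rewrite /fcoef big1_seq // => l /andP[/eqP lE lL].
have E n : (iter n slide d i0).1 = (d i0).1 + n%:R.
  elim: n => [|n IH]; first by rewrite addr0.
  by rewrite iterS /slide !ffunE (negbTE ij0) eqxx /= IH -addrA natr1.
have := leq_trans (_ : (_ <= _)%N) hm; rewrite (big_rem l) //= => /(_ _ (leq_maxl _ _)).
rewrite lE E ReD Re_nat addrAC subrr add0r => h.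
by have := truncnS_gt (m%:R : R); rewrite ltr_nat ltnNge h.
Qed.

Lemma eventually_zeroB a b : eventually_zero a -> eventually_zero b ->
  eventually_zero (fun d => a d - b d).
Proof.
move=> ha hb d; have [m1 h1] := ha d; have [m2 h2] := hb d.
by exists (maxn m1 m2) => m; rewrite geq_max => /andP[/h1 -> /h2 ->]; rewrite subrr.
Qed.

Definition set2 e (x : exps * exps) : idx :=
  [ffun l => if l == i0 then x.1 else if l == j0 then x.2 else e l].

Lemma set2_dn1 e x : idx_dn i0 (set2 e x) = set2 e (pair_dn1 x).
Proof. by apply/ffunP => l; rewrite !ffunE; case: eqP. Qed.

Lemma set2_dn2 e x : idx_dn j0 (set2 e x) = set2 e (pair_dn2 x).
Proof.
apply/ffunP => l; rewrite !ffunE; case: eqP => // ->.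
by rewrite eq_sym (negbTE ij0).
Qed.

Lemma iter_mul_diff_set2 t c e x : iter t (mul_diff i0 j0) c (set2 e x) =
  iter t pair_mul (fun y => c (set2 e y)) x.
Proof.
elim: t x => //= t IH x; rewrite /mul_diff /pair_mul /diff_op -!/(mul_diff _ _) -!/(pair_mul).
by rewrite set2_dn1 set2_dn2 !IH.
Qed.

Lemma same_fiber_set2 e d : same_fiber e d -> d = set2 e (d i0, d j0).
Proof.
move=> ed; apply/ffunP => l; rewrite ffunE /=.
by case: eqP => [->//|/eqP l1]; case: eqP => [->//|/eqP l2]; rewrite ed.
Qed.

End Locality.
End SeveralVariables.
End FormalSeries.

(** * Generalized eigenvectors *)

Section GeneralizedEigenvectors.
Variables (R : realType) (E : lmodType R[i]) (T : {linear E -> E}).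
Implicit Types (a b : R[i]) (x y v : E) (r s : seq R[i]).

Definition eig_op a x : E := T x - a *: x.

Lemma eig_opD a x y : eig_op a (x + y) = eig_op a x + eig_op a y.
Proof. by rewrite /eig_op linearD scalerDr opprD addrACA. Qed.

Lemma eig_opZ a b x : eig_op a (b *: x) = b *: eig_op a x.
Proof. by rewrite /eig_op linearZ_LR scalerBr !scalerA mulrC. Qed.

Lemma eig_op0 a : eig_op a 0 = 0.
Proof. by rewrite /eig_op linear0 scaler0 subrr. Qed.

Lemma eig_op_sum (J : Type) (l : seq J) (P : pred J) (F : J -> E) a :
  eig_op a (\sum_(i <- l | P i) F i) = \sum_(i <- l | P i) eig_op a (F i).
Proof. exact: (big_morph (eig_op a) (eig_opD a) (eig_op0 a)). Qed.

Lemma eig_opC a b x : eig_op a (eig_op b x) = eig_op b (eig_op a x).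
Proof.
rewrite /eig_op !(linearB T) !(linearZ_LR T) /= !scalerBr !scalerA [b * a]mulrC.
have E4 (p q t w : E) : p - q - (t - w) = p - t - (q - w).
  by rewrite !opprB addrACA [RHS]addrACA [- q - t]addrC.
exact: E4.
Qed.

Lemma iter_eig_opD m a x y :
  iter m (eig_op a) (x + y) = iter m (eig_op a) x + iter m (eig_op a) y.
Proof. by elim: m => //= m ->; rewrite eig_opD. Qed.

Lemma iter_eig_op0 m a : iter m (eig_op a) 0 = 0.
Proof. by elim: m => //= m ->; rewrite eig_op0. Qed.

Lemma iter_eig_op_le m m' a x : (m <= m')%N -> iter m (eig_op a) x = 0 ->
  iter m' (eig_op a) x = 0.
Proof. by move=> /subnK <- h; rewrite iterD h iter_eig_op0. Qed.

Lemma nilp0 a : nilpotent_on T a 0.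
Proof. by exists 0%N. Qed.

Lemma nilpD a x y : nilpotent_on T a x -> nilpotent_on T a y -> nilpotent_on T a (x + y).
Proof.
move=> [m hm] [n hn]; exists (maxn m n); rewrite -[fun u => _]/(eig_op a) iter_eig_opD.
by rewrite (iter_eig_op_le (leq_maxl m n) hm) (iter_eig_op_le (leq_maxr m n) hn) addr0.
Qed.

Lemma nilp_eig_op a b x : nilpotent_on T a x -> nilpotent_on T a (eig_op b x).
Proof.
move=> [m hm]; exists m; rewrite -[fun u => _]/(eig_op a).
have -> : iter m (eig_op a) (eig_op b x) = eig_op b (iter m (eig_op a) x).
  by elim: (m) => //= n ->; rewrite eig_opC.
by rewrite [iter _ _ _]hm eig_op0.
Qed.

Lemma nilpZ a b x : nilpotent_on T a x -> nilpotent_on T a (b *: x).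
Proof.
move=> [m hm]; exists m; rewrite -[fun u => _]/(eig_op a).
have -> : iter m (eig_op a) (b *: x) = b *: (iter m (eig_op a) x).
  by elim: (m) => //= n ->; rewrite eig_opZ.
by rewrite [iter _ _ _]hm scaler0.
Qed.

Lemma nilp_sum (J : eqType) (l : seq J) (F : J -> E) a :
  (forall i, i \in l -> nilpotent_on T a (F i)) -> nilpotent_on T a (\sum_(i <- l) F i).
Proof.
elim: l => [|i l IH] h; first by rewrite big_nil; exact: nilp0.
rewrite big_cons; apply: nilpD; first by apply: h; rewrite mem_head.
by apply: IH => j jl; apply: h; rewrite inE jl orbT.
Qed.

Lemma nilp_step a x : nilpotent_on T a (eig_op a x) -> nilpotent_on T a x.
Proof. by move=> [m hm]; exists m.+1; rewrite iterSr. Qed.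

Lemma eig_op_inj a b x : nilpotent_on T a x -> b != a -> eig_op b x = 0 -> x = 0.
Proof.
move=> [m hm] ba /eqP; rewrite subr_eq0 => /eqP bx.
have {hm} : (b - a) ^+ m *: x = 0.
  rewrite -[RHS]hm -[fun u => _]/(eig_op a); elim: (m) => [|n IH] /=; first by rewrite expr0 scale1r.
  by rewrite -IH eig_opZ /eig_op bx -scalerBl scalerA exprSr.
by move/eqP; rewrite scaler_eq0 expf_eq0 subr_eq0 (negbTE ba) andbF => /eqP.
Qed.

Definition eig_prod r x : E := foldr eig_op x r.

Lemma nilp_eig_prod a r x : nilpotent_on T a x -> nilpotent_on T a (eig_prod r x).
Proof. by move=> hx; elim: r => [|c r IH] //=; apply: nilp_eig_op. Qed.

Lemma eig_prod_inj a r x : nilpotent_on T a x -> a \notin r -> eig_prod r x = 0 -> x = 0.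
Proof.
move=> hx; elim: r => //= b r IH; rewrite inE negb_or => /andP[ab ar] h.
apply: IH => //; apply: (@eig_op_inj a b) h; last by rewrite eq_sym.
exact: nilp_eig_prod.
Qed.

Lemma eig_prod0 r : eig_prod r 0 = 0.
Proof. by elim: r => //= a r ->; rewrite eig_op0. Qed.

Lemma eig_prod_eig_op r a x : eig_prod r (eig_op a x) = eig_op a (eig_prod r x).
Proof. by elim: r => //= b r ->; rewrite eig_opC. Qed.

Lemma eig_prodC r s x : eig_prod r (eig_prod s x) = eig_prod s (eig_prod r x).
Proof. by elim: r => //= a r IH; rewrite IH eig_prod_eig_op. Qed.

Lemma eig_prod_sum (J : Type) (l : seq J) (P : pred J) (F : J -> E) r :
  eig_prod r (\sum_(i <- l | P i) F i) = \sum_(i <- l | P i) eig_prod r (F i).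
Proof. by elim: r => //= a r ->; rewrite eig_op_sum. Qed.

Lemma nilp_killed (J : eqType) (l : seq J) (phi : J -> R[i]) (F : J -> E) :
  (forall i, i \in l -> nilpotent_on T (phi i) (F i)) ->
  exists2 r, {subset r <= [seq phi i | i <- l]} &
    forall i, i \in l -> eig_prod r (F i) = 0.
Proof.
elim: l => [|i l IH] h; first by exists [::].
have [|r rl hr] := IH; first by move=> j jl; apply: h; rewrite inE jl orbT.
have [m hm] := h i (mem_head _ _); exists (nseq m (phi i) ++ r) => [a|j].
  rewrite mem_cat mem_nseq inE => /orP[/andP[_ ->]//|/rl ->]; by rewrite orbT.
rewrite inE /eig_prod foldr_cat -/(eig_prod r _) -/(eig_prod _ _) => /orP[/eqP ->|/hr ->].
  rewrite eig_prodC [X in eig_prod r X](_ : _ = 0) ?eig_prod0 // -[RHS]hm.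
  by elim: (m) => //= n ->.
exact: eig_prod0.
Qed.

(** Generalized eigenvectors for distinct eigenvalues are independent, so the
  components of a generalized eigenvector with another eigenvalue vanish. *)
Lemma grading_nilp (I : choiceType) (G : I -> set E) (phi : I -> R[i])
    (J : {fset I}) (f : I -> E) a : is_grading G ->
  (forall i x, G i x -> nilpotent_on T (phi i) x) ->
  (forall i, i \in J -> G i (f i)) -> nilpotent_on T a (\sum_(i <- J) f i) ->
  forall i, i \in J -> phi i != a -> f i = 0.
Proof.
move=> gr Gn Jf hn i iJ ia.
pose f1 i := if phi i == a then 0 else f i; pose f2 i := if phi i == a then f i else 0.
have sumE : \sum_(i <- J) f1 i = \sum_(i <- J) f i - \sum_(i <- J) f2 i.
  rewrite -sumrB; apply: eq_bigr => j _; rewrite /f1 /f2.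
  by case: eqP; rewrite ?subrr ?subr0.
have f1_nilp : nilpotent_on T a (\sum_(i <- J) f1 i).
  rewrite sumE -scaleN1r; apply: nilpD hn (nilpZ _ _); apply: nilp_sum => j jJ.
  rewrite /f2; case: eqP => [<-|_]; last exact: nilp0.
  by apply: Gn; apply: Jf.
have [|r rJ hr] := @nilp_killed _ [seq j <- J | phi j != a] phi f1.
  move=> j; rewrite mem_filter => /andP[ja jJ]; rewrite /f1 (negbTE ja).
  by apply: Gn; apply: Jf.
have ar : a \notin r.
  by apply/negP => /rJ/mapP[j]; rewrite mem_filter => /andP[/eqP ja _] /esym.
have f1s : \sum_(i <- J) f1 i = 0.
  apply: (eig_prod_inj f1_nilp ar); rewrite eig_prod_sum big1_seq // => j /andP[_ jJ].
  have [ja|ja] := eqVneq (phi j) a; first by rewrite /f1 ja eqxx eig_prod0.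
  by apply: hr; rewrite mem_filter ja.
have := grading_free gr _ f1s iJ; rewrite /f1 (negbTE ia); apply => j jJ.
case: ifP => _; [exact: grading0 gr j|exact: Jf].
Qed.

Section FiniteDimension.
Variable S : set E.
Hypothesis S0 : S 0.
Hypothesis SP : forall a x y, S x -> S y -> S (a *: x + y).
Hypothesis ST : forall x, S x -> S (T x).

Lemma S_eig_op a x : S x -> S (eig_op a x).
Proof. by move=> Sx; rewrite /eig_op addrC -scaleNr; apply: SP => //; exact: ST. Qed.

(** On the generalized eigenspace of [a], the operator [T - b] is the sum of [a - b]
  and a locally nilpotent operator. *)
Lemma eig_op_solve a b x : S x -> nilpotent_on T a x -> b != a ->
  exists y, [/\ S y, nilpotent_on T a y & eig_op b y = x].
Proof.
move=> Sx [m hm] ba; elim: m x Sx hm => [|m IH] x Sx hm.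
  by exists 0; split; [|exact: nilp0|rewrite eig_op0; exact: esym].
have [|y [Sy ny yE]] := IH _ (S_eig_op a Sx); first by rewrite -iterSr.
have nx : nilpotent_on T a x by exists m.+1.
have ab : a - b != 0 by rewrite subr_eq0 eq_sym.
have SB : S (x - y) by rewrite -[x]scale1r; rewrite addrC -scaleN1r; apply: SP => //; rewrite scale1r.
exists ((a - b)^-1 *: (x - y)); split.
- by rewrite -[_ *: _]addr0; apply: SP.
- by apply/nilpZ/nilpD => //; rewrite -scaleN1r; apply: nilpZ.
rewrite eig_opZ eig_opD -[- y]scaleN1r eig_opZ yE scaleN1r /eig_op opprB.
rewrite [a *: x - _]addrC addrACA subrr add0r addrC -scalerBl scalerA mulVf //.
by rewrite scale1r.
Qed.

(** Induction on the roots: a preimage under [T - b] is found for each component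
  with another eigenvalue, and what is left is a generalized eigenvector for [b]. *)
Lemma eig_decomp r v : S v -> eig_prod r v = 0 ->
  exists2 l : seq (R[i] * E), v = \sum_(c <- l) c.2 &
    forall c, c \in l -> S c.2 /\ nilpotent_on T c.1 c.2.
Proof.
elim: r v => [|b r IH] v Sv /=.
  by move=> ->; exists [::] => //; rewrite big_nil.
rewrite -eig_prod_eig_op => /(IH _ (S_eig_op b Sv))[l lE hl].
suff [l' l'P nb] : exists2 l' : seq (R[i] * E),
    (forall c, c \in l' -> S c.2 /\ nilpotent_on T c.1 c.2) &
    nilpotent_on T b (\sum_(c <- l) c.2 - eig_op b (\sum_(c <- l') c.2)).
  exists ((b, v - \sum_(c <- l') c.2) :: l'); first by rewrite big_cons subrK.
  move=> c; rewrite inE => /orP[/eqP ->|/l'P//] /=; split.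
    rewrite addrC -scaleN1r; apply: SP => //.
    elim: l' l'P {nb} => [|c' l' IHl] h; first by rewrite big_nil.
    rewrite big_cons -[c'.2]scale1r; apply: SP; first by have [] := h _ (mem_head _ _).
    by apply: IHl => d dl; apply: h; rewrite inE dl orbT.
  apply: nilp_step; rewrite eig_opD lE -[- \sum_(c <- l') _]scaleN1r eig_opZ scaleN1r.
  exact: nb.
elim: l hl {lE} => [|[a x] l IHl] hl.
  by exists [::] => //; rewrite !big_nil eig_op0 subrr; exact: nilp0.
have [|l' l'P nb] := IHl; first by move=> c cl; apply: hl; rewrite inE cl orbT.
have [Sx nx] := hl _ (mem_head _ _).
have [ab|ab] := eqVneq b a.
  exists l' => //; rewrite big_cons -addrA; apply: nilpD nb; by rewrite ab.
have [y [Sy ny yE]] := eig_op_solve Sx nx ab.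
exists ((a, y) :: l'); last by rewrite !big_cons eig_opD yE opprD addrACA subrr add0r.
by move=> c; rewrite inE => /orP[/eqP ->|/l'P].
Qed.

Definition poly_act (p : {poly R[i]}) v : E := \sum_(i < size p) p`_i *: iter i T v.

Lemma poly_actE n (p : {poly R[i]}) v : (size p <= n)%N ->
  poly_act p v = \sum_(i < n) p`_i *: iter i T v.
Proof.
move=> pn; rewrite /poly_act (big_ord_widen n (fun i => p`_i *: iter i T v)) //.
rewrite big_mkcond /=; apply: eq_bigr => i _; case: ltnP => // /(nth_default 0) ->.
by rewrite scale0r.
Qed.

Lemma poly_act_XsubC b (p : {poly R[i]}) v : poly_act (('X - b%:P) * p) v = eig_op b (poly_act p v).
Proof.
rewrite (@poly_actE (size p).+1); last first.
  have [->|p0] := eqVneq p 0; first by rewrite mulr0 size_poly0.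
  by rewrite size_monicM ?monicXsubC // size_XsubC.
rewrite /eig_op; under eq_bigr do rewrite mulrBl coefB coefXM coefCM scalerBl.
rewrite sumrB; congr (_ - _).
  rewrite big_ord_recl /= scale0r add0r linear_sum; apply: eq_bigr => i _.
  by rewrite linearZ_LR.
rewrite (poly_actE v (leqnSn _)) scaler_sumr; apply: eq_bigr => i _.
by rewrite scalerA.
Qed.

Lemma poly_act_prod r v : poly_act (\prod_(b <- r) ('X - b%:P)) v = eig_prod r v.
Proof.
elim: r => [|b r IH] /=; last by rewrite big_cons poly_act_XsubC IH.
by rewrite big_nil /poly_act size_poly1 big_ord1 coefC eqxx scale1r.
Qed.

(** The iterates of a vector under [T] are linearly dependent, and the polynomial of
  this relation splits into linear factors over the complex numbers. *)
Lemma findim_eigen_span (d : nat) (e : 'I_d -> E) :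
  (forall v, S v -> exists c : 'I_d -> R[i], v = \sum_i c i *: e i) ->
  forall v, S v -> exists2 l : seq (R[i] * E), v = \sum_(c <- l) c.2 &
    forall c, c \in l -> S c.2 /\ nilpotent_on T c.1 c.2.
Proof.
move=> span v Sv.
have Siter j : S (iter j T v) by elim: j => //= j; exact: ST.
have /choice[c cE] : forall j, exists c : 'I_d -> R[i], iter j T v = \sum_i c i *: e i.
  by move=> j; exact: span.
pose C := \matrix_(j < d.+1, i < d) c j i.
have kC : kermx C != 0.
  by rewrite kermx_eq0 /row_free neq_ltn ltnS rank_leq_col.
pose u := nz_row (kermx C); have u0 : u != 0 by rewrite nz_row_eq0.
have uC : u *m C = 0 by apply/sub_kermxP; exact: nz_row_sub.
pose p := \poly_(j < d.+1) u 0 (inord j).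
have p0 : p != 0.
  apply: contraNneq u0 => p0; apply/eqP/rowP => j; rewrite mxE.
  have := congr1 (fun q : {poly R[i]} => q`_j) p0.
  by rewrite coef_poly ltn_ord coef0 inord_val.
have pv : poly_act p v = 0.
  rewrite (poly_actE v (size_poly _ _)).
  under eq_bigr => j _ do rewrite coef_poly ltn_ord inord_val cE scaler_sumr.
  rewrite exchange_big big1 //= => i _; under eq_bigr do rewrite scalerA.
  have uCi : \sum_(j < d.+1) u 0 j * c j i = 0.
    transitivity ((u *m C) 0 i); last by rewrite uC mxE.
    rewrite [RHS]mxE; by apply: eq_bigr => j _; rewrite [C _ _]mxE.
  by rewrite -scaler_suml uCi scale0r.
have [r rE] := closed_field_poly_normal p.
apply: (@eig_decomp r) => //; rewrite -poly_act_prod.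
have lp0 : lead_coef p != 0 by rewrite lead_coef_eq0.
set P := \prod_(_ <- _) _ in rE *.
have : lead_coef p *: poly_act P v = 0.
  rewrite -pv {2}rE (@poly_actE (size P) (lead_coef p *: P)) ?size_scale //.
  by rewrite /poly_act scaler_sumr; apply: eq_bigr => i _; rewrite coefZ scalerA.
by move/eqP; rewrite scaler_eq0 (negbTE lp0) => /eqP.
Qed.

End FiniteDimension.
End GeneralizedEigenvectors.

(** * Weights, gradings and the graded dual *)

Lemma seq_lower_bound (R : realDomainType) (s : seq R) : exists b, forall x, x \in s -> b <= x.
Proof.
elim: s => [|a s [b hb]]; first by exists 0.
exists (Num.min a b) => x; rewrite inE ge_min => /orP[/eqP ->|/hb ->]; first by rewrite lexx.
by rewrite orbT.
Qed.

Definition scalar_of (R : pzRingType) (E : lmodType R) (f : E -> R) (hf : scalar f) :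
  {scalar E} := HB.pack f (GRing.isLinear.Build R E R *%R f hf).

Section SuperalgebraElements.
Variables (R : realType) (V : vertex_superalgebra R) (g : {linear V -> V}).
Hypothesis hg : is_automorphism g.

(** The elements to which multilinearity reduces the theorem: the weight controls
  the weights of the module, the eigenvalue controls the exponents of [z]. *)
Definition homogeneous (h : int) (al : R[i]) (v : V) : Prop :=
  [/\ vsa_wt h v, gen_eigen g al v & 0 <= complex.Re al < 1].

Lemma homogeneous_span h v : vsa_wt h v ->
  exists2 l : seq V, v = \sum_(x <- l) x & forall x, x \in l -> exists al, homogeneous h al x.
Proof.
move=> hv; have [d [e he]] := vsa_wt_findim V h.
have gr := vsa_grading V.
have [l -> hl] := @findim_eigen_span _ _ g (@vsa_wt R V h) (grading0 gr h)
  (@gradingP _ _ _ _ gr h) (fun x => @aut_wt _ _ _ hg h x) d e he v hv.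
elim: l hl => [|[a x] l IH] hl; first by exists [::]; rewrite ?big_nil.
have [|l' lE hl'] := IH; first by move=> c cl; apply: hl; rewrite inE cl orbT.
have [/= hx nx] := hl _ (mem_head _ _); rewrite big_cons /=.
have [a0|a0] := eqVneq a 0.
  exists l' => //; rewrite lE; suff -> : x = 0 by rewrite add0r.
  have [m hm] := nx; have ginj := bij_inj (aut_bij hg).
  elim: m hm => //= m IHm; rewrite [X in X *: _]a0 scale0r subr0 => h0; apply: IHm.
  by apply: ginj; rewrite h0 linear0.
exists (x :: l'); first by rewrite big_cons lE.
move=> y; rewrite inE => /orP[/eqP ->|/hl'//]; exists (strip_log a); split => //.
  by rewrite /gen_eigen strip_logK.
exact: strip_log_bound.
Qed.

Lemma wt_parity h (v : V) : vsa_wt h v -> parity (odd `|h|%N) v.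
Proof.
move=> hv; exists [fset h]%fset, (fun=> v); split; last by rewrite big_seq_fset1.
by move=> i; rewrite inE => /eqP ->.
Qed.

End SuperalgebraElements.

Section TwistedModule.
Variables (R : realType) (V : vertex_superalgebra R) (g : {linear V -> V}).
Variable W : twisted_module g.
Local Notation G := (@tw_gr R V g W).
Local Notation Rei := (@complex.Re R).
Implicit Types (v : V) (x : W).

Lemma tw_YlD v1 v2 x d : tw_Y (v1 + v2) x d = tw_Y v1 x d + tw_Y v2 x d.
Proof. by rewrite -[v1]scale1r (@tw_Y_linearl _ _ _ W x d) !scale1r. Qed.

Lemma tw_Yl0 x d : tw_Y (0 : V) x d = 0.
Proof. by have /eqP := tw_YlD 0 0 x d; rewrite addr0 -subr_eq0 opprD addNKr oppr_eq0 => /eqP. Qed.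

Lemma tw_YlZ a v x d : tw_Y (a *: v) x d = a *: tw_Y v x d.
Proof. by rewrite -[a *: v]addr0 (@tw_Y_linearl _ _ _ W x d) tw_Yl0 addr0. Qed.

Lemma tw_YrD v x1 x2 d : tw_Y v (x1 + x2) d = tw_Y v x1 d + tw_Y v x2 d.
Proof. by rewrite -[x1]scale1r (@tw_Y_linearr _ _ _ W v d) !scale1r. Qed.

Lemma tw_Yr0 v d : tw_Y v (0 : W) d = 0.
Proof. by have /eqP := tw_YrD v 0 0 d; rewrite addr0 -subr_eq0 opprD addNKr oppr_eq0 => /eqP. Qed.

Lemma tw_YrZ a v x d : tw_Y v (a *: x) d = a *: tw_Y v x d.
Proof. by rewrite -[a *: x]addr0 (@tw_Y_linearr _ _ _ W v d) tw_Yr0 addr0. Qed.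

Lemma tw_Yr_sum (J : Type) (l : seq J) (F : J -> W) v d :
  tw_Y v (\sum_(i <- l) F i) d = \sum_(i <- l) tw_Y v (F i) d.
Proof. exact: (big_morph (fun x => tw_Y v x d) (fun x y => tw_YrD v x y d) (tw_Yr0 v d)). Qed.

Lemma in_coprod1 (P : set (R[i] * bool * R[i])) i x : P i -> G i x -> in_coprod G P x.
Proof.
move=> Pi Gx; exists [fset i]%fset, (fun=> x); split; last by rewrite big_seq_fset1.
by move=> j; rewrite inE => /eqP ->.
Qed.

Lemma weight_nilp i x : G i x -> nilpotent_on (tw_L0 W) i.1.1 x.
Proof. by move=> Gx; apply: tw_L0_nilp; apply: (in_coprod1 (i := i)). Qed.

Lemma gweight_nilp i x : G i x -> nilpotent_on (tw_g W) (cexp2pi i.2) x.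
Proof. by move=> Gx; apply: tw_g_nilp; apply: (in_coprod1 (i := i)). Qed.

Lemma components x : exists (J : {fset R[i] * bool * R[i]}) f,
  (forall i, i \in J -> G i (f i)) /\ x = \sum_(i <- J) f i.
Proof.
have [J [f [hf ->]]] := grading_span (tw_grading W) x.
by exists J, f; split=> // i /hf[].
Qed.

(** The commutator of [L0] with the coefficient of [z^m (log z)^q] involves that of
  [z^m (log z)^(q + 1)], hence a descending induction on [q]. *)
Lemma L0_Y h v n x m q : vsa_wt h v -> nilpotent_on (tw_L0 W) n x ->
  nilpotent_on (tw_L0 W) (n + h%:~R / 2 + m) (tw_Y v x (m, q)).
Proof.
move=> hv [N hN]; elim: N x hN q => [|N IH] x hN q.
  by rewrite (_ : x = 0) ?tw_Yr0; [exact: nilp0|exact: hN].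
have stepE q' : eig_op (tw_L0 W) (n + h%:~R / 2 + m) (tw_Y v x (m, q')) =
    tw_Y v (eig_op (tw_L0 W) n x) (m, q') + q'.+1%:R *: tw_Y v x (m, q'.+1).
  have /eqP := @tw_L0_comm _ _ _ W v x m q'; rewrite subr_eq => /eqP.
  rewrite (vsa_L0E hv) tw_YlZ /eig_op => ->.
  rewrite -[- (n *: x)]scaleNr tw_YrD tw_YrZ !scalerDl scaleNr.
  set a := m *: _; set b := (_ / 2) *: _; set c := n *: _; set e := tw_Y v (_ x) _.
  set f := _ *: tw_Y _ _ _; apply/eqP; rewrite subr_eq -!addrA; apply/eqP.
  rewrite [in RHS](addrCA f) addKr [RHS]addrC -!addrA addrCA; congr (_ + _).
  by rewrite addrCA.
have [K hK] := @tw_Y_log _ _ _ W v x.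
have [j jq] : exists j, (K <= j + q)%N by exists K; exact: leq_addr.
elim: j q jq => [|j IHj] q jq; first by rewrite hK //; exact: nilp0.
apply: nilp_step; rewrite stepE; apply: nilpD; first by apply: IH; rewrite -iterSr.
by apply: nilpZ; apply: IHj; rewrite addnS.
Qed.

(** [(g - a b) (Y v x) = Y ((g - a) v) (g x) + a Y v ((g - b) x)]. *)
Lemma g_Y a b v x d : nilpotent_on g a v -> nilpotent_on (tw_g W) b x ->
  nilpotent_on (tw_g W) (a * b) (tw_Y v x d).
Proof.
move=> [m hm]; elim: m v hm x => [|m IHm] v hm x.
  by rewrite (_ : v = 0) ?tw_Yl0; [move=> _; exact: nilp0|exact: hm].
move=> [n hn]; elim: n x hn => [|n IHn] x hn.
  by rewrite (_ : x = 0) ?tw_Yr0; [exact: nilp0|exact: hn].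
apply: nilp_step.
have -> : eig_op (tw_g W) (a * b) (tw_Y v x d) =
    tw_Y (eig_op g a v) (tw_g W x) d + a *: tw_Y v (eig_op (tw_g W) b x) d.
  rewrite /eig_op tw_g_Y -[- (a *: v)]scaleN1r tw_YlD !tw_YlZ scaleN1r.
  by rewrite -[- (b *: x)]scaleN1r tw_YrD !tw_YrZ scaleN1r scalerBr scalerA addrA subrK.
apply: nilpD; last by apply/nilpZ/IHn; rewrite -iterSr.
apply: IHm; first by rewrite -iterSr.
have : nilpotent_on (tw_g W) b x by exists n.+1.
move=> nx; rewrite -[tw_g W x](subrK (b *: x)); apply: nilpD (nilpZ _ nx).
exact: nilp_eig_op.
Qed.

(** A vector on which the functional does not vanish has a nonzero component in the
  support of the functional, and this component carries the eigenvalues of the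
  vector. *)
Lemma dual_component (w' : {scalar W}) : graded_dual w' ->
  exists J : {fset R[i] * bool * R[i]}, forall y, w' y != 0 -> exists2 i, i \in J &
    (forall n, nilpotent_on (tw_L0 W) n y -> i.1.1 = n) /\
    (forall la, nilpotent_on (tw_g W) la y -> cexp2pi i.2 = la).
Proof.
move=> [J hJ]; exists J => y w'y; have [J1 [f [hf yE]]] := components y.
have [i iJ1 fi] : exists2 i, i \in J1 & w' (f i) != 0.
  apply/hasP; apply: contraNT w'y => /hasPn h.
  rewrite yE linear_sum big1_seq // => i /andP[_ iJ].
  by apply/eqP/negPn/h.
have f0 : f i != 0 by apply: contraNneq fi => ->; rewrite linear0.
exists i; first by apply: contraNT fi => iJ; rewrite (hJ i) //; exact: hf.
split=> [n ny|la gy]; apply/eqP; apply: contraNT f0 => h; apply/eqP.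
  apply: (grading_nilp (phi := fun i => i.1.1) (tw_grading W) weight_nilp hf _ iJ1 h).
  by rewrite -yE.
apply: (grading_nilp (phi := fun i => cexp2pi i.2) (tw_grading W) gweight_nilp hf _ iJ1 h).
by rewrite -yE.
Qed.

Lemma tw_strip i x : G i x -> x != 0 -> 0 <= Rei i.2 < 1.
Proof.
case: i => [[n s] a] Gx x0; apply: (@tw_P_strip _ _ _ W).
by apply: contrapT => na; case/eqP: x0; apply: tw_gr_P Gx na.
Qed.

(** The weight of a vector on which the new functional does not vanish is determined
  by that of its image. So is the [g]-weight, up to an integer, and it lies in the
  strip; thus finitely many pairs of weights occur. *)
Lemma dual_Y h al v (w' : {scalar W}) d : homogeneous g h al v -> graded_dual w' ->
  exists2 w'' : {scalar W}, graded_dual w'' & forall x, w'' x = w' (tw_Y v x d).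
Proof.
move=> [hv gv al01] hw'; have lin : scalar (fun x : W => w' (tw_Y v x d)).
  by move=> a x y; rewrite tw_YrD tw_YrZ linearP.
exists (scalar_of lin) => //; have [J hJ] := dual_component hw'.
exists [fset x in [seq (i.1.1 - h%:~R / 2 - d.1, s, strip_log (cexp2pi i.2 / cexp2pi al))
  | i <- J, s <- [:: true; false]]]%fset => i x iN Gx; apply/eqP.
have [->|x0] := eqVneq x 0; first by rewrite linear0.
apply: contraNT iN => w'x; rewrite inE.
have {}w'x : w' (tw_Y v x (d.1, d.2)) != 0 by rewrite -surjective_pairing.
have [j jJ [jn ja]] := hJ _ w'x.
have {}jn := jn _ (L0_Y d.1 d.2 hv (weight_nilp Gx)).
have {}ja := ja _ (g_Y (d.1, d.2) gv (gweight_nilp Gx)).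
apply/allpairsP; exists (j, i.1.2); split => //=; first by case: (i.1.2).
rewrite jn ja mulrAC divff ?cexp2pi_neq0 // mul1r (cexp2piK (tw_strip Gx x0)).
by rewrite addrAC !addrK; case: (i) => [[]].
Qed.

Lemma dual_prefix k (hh : 'I_k -> int) (al : 'I_k -> R[i]) (vv : 'I_k -> V)
    (dd : 'I_k -> R[i] * nat) (s : seq 'I_k) (w' : {scalar W}) :
  (forall i, homogeneous g (hh i) (al i) (vv i)) -> graded_dual w' ->
  exists2 w'' : {scalar W}, graded_dual w'' &
    forall x, w'' x = w' (foldr (fun i y => tw_Y (vv i) y (dd i)) x s).
Proof.
move=> hv; elim: s w' => [|i s IH] w' hw' /=; first by exists w'.
have [w1 hw1 w1E] := dual_Y (dd i) (hv i) hw'.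
by have [w2 hw2 w2E] := IH _ hw1; exists w2 => // x; rewrite w2E w1E.
Qed.

Section LowerBound.
Hypothesis hW : lower_bounded W.

Lemma weight_bound : exists B : R, forall n y, nilpotent_on (tw_L0 W) n y ->
  Rei n < B -> y = 0.
Proof.
have [B hB] := hW; exists B => n y ny nB; apply: (hB n) => //.
have [J [f [hf yE]]] := components y; exists [fset i in J | i.1.1 == n]%fset, f.
split=> [i|]; first by rewrite !inE => /andP[iJ /eqP iE]; split; [exact: iE|exact: hf].
rewrite yE (big_fsetID _ (fun i => i.1.1 == n)) /= [X in _ + X]big1_seq ?addr0 //.
move=> i; rewrite !inE /= => /andP[iJ iN].
apply: (grading_nilp (phi := fun i => i.1.1) (tw_grading W) weight_nilp hf _ iJ iN).
by rewrite -yE.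
Qed.

Lemma Y_lower_truncated h v x : vsa_wt h v -> exists B : R, forall m q, Rei m < B ->
  tw_Y v x (m, q) = 0.
Proof.
move=> hv; have [B hB] := weight_bound; have [J [f [hf ->]]] := components x.
have [b hb] := seq_lower_bound [seq B - Rei i.1.1 - Rei (h%:~R / 2) | i <- J].
exists b => m q mb; rewrite tw_Yr_sum big1_seq // => i /andP[_ iJ].
apply: (hB _ _ (L0_Y m q hv (weight_nilp (hf i iJ)))); rewrite !ReD.
have := hb _ (map_f _ iJ); rewrite /=; lra.
Qed.

End LowerBound.
End TwistedModule.

(** * Exponents of a twisted vertex operator *)

Section ExponentCosets.
Variables (R : realType) (V : vertex_superalgebra R) (g : {linear V -> V}).
Hypothesis hg : is_automorphism g.
Variable W : twisted_module g.
Local Notation "x %:C" := (real_complex R x).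
Local Notation Rei := (@complex.Re R).

Lemma coef_finite h (v : V) (x : W) (w' : {scalar W}) : vsa_wt h v -> graded_dual w' ->
  exists (r : seq R[i]) (K : nat), forall n q, w' (tw_Y v x (n, q)) != 0 -> n \in r /\ (q < K)%N.
Proof.
move=> hv hw'; have [J hJ] := dual_component hw'; have [J1 [f [hf xE]]] := components x.
have [K hK] := @tw_Y_log _ _ _ W v x.
exists [seq j.1.1 - i.1.1 - h%:~R / 2 | j <- J, i <- J1], K => n q nz; split; last first.
  by rewrite ltnNge; apply: contra nz => /hK ->; rewrite linear0.
have [i iJ1 fi] : exists2 i, i \in J1 & w' (tw_Y v (f i) (n, q)) != 0.
  apply/hasP; apply: contraNT nz => /hasPn H.
  rewrite xE tw_Yr_sum linear_sum big1_seq // => i /andP[_ iJ].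
  by apply/eqP/negPn/H.
have [j jJ [jn _]] := hJ _ fi; have {}jn := jn _ (L0_Y n q hv (weight_nilp (hf i iJ1))).
apply/allpairsP; exists (j, i); split=> //=.
by rewrite jn addrAC [_ + _ + n]addrAC !addrK addrAC subrr add0r.
Qed.

Section Coefficients.
Variables (x : W) (w' : {scalar W}) (r : seq R[i]) (K : nat).
Hypothesis ur : uniq r.

Definition log_poly (v : V) (n : R[i]) : {poly R[i]} := \poly_(q < K) w' (tw_Y v x (n, q)).

Definition coef_within (v : V) :=
  forall n q, w' (tw_Y v x (n, q)) != 0 -> n \in r /\ (q < K)%N.

Lemma coef_log_poly v n q : coef_within v -> (log_poly v n)`_q = w' (tw_Y v x (n, q)).
Proof.
move=> hv; rewrite coef_poly; case: ltnP => // Kq; apply/esym/eqP; apply: contraTT Kq.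
by move=> /hv[_]; rewrite ltnNge.
Qed.

Lemma log_poly_sums v p (z : R[i]) : coef_within v ->
  abs_sums_to (fun d => w' (tw_Y v x d) * mono p z d)
    (\sum_(n <- r) cexp (n * lp p z) * (log_poly v n).[lp p z]).
Proof.
move=> hv; pose l := [seq (n, q) | n <- r, q <- iota 0 K].
have := @sums_fin R _ (fun d => w' (tw_Y v x d) * mono p z d) l.
have -> : \sum_(d <- l) w' (tw_Y v x d) * mono p z d =
    \sum_(n <- r) cexp (n * lp p z) * (log_poly v n).[lp p z].
  rewrite big_allpairs_dep; apply: eq_bigr => n _; rewrite horner_poly mulr_sumr.
  rewrite -{1}(subn0 K) -/(index_iota 0 K) big_mkord; apply: eq_bigr => q _.
  by rewrite /mono /= mulrCA.
apply; first by apply: allpairs_uniq => //; [exact: iota_uniq|move=> [? ?] [? ?]].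
move=> [n q] nq; have [->|/hv[nr qK]] := eqVneq (w' (tw_Y v x (n, q))) 0; first by rewrite mul0r.
by case/negP: nq; apply/allpairsP; exists (n, q); rewrite mem_iota.
Qed.

(** Rotating [z] once around the origin multiplies [z^n] by [e^(2 pi i n)] and
  translates [log z] by [2 pi i]; equivariance identifies the result. *)
Lemma log_poly_monodromy v n : graded_dual w' -> coef_within v -> coef_within (g v) ->
  log_poly v n = cexp2pi n *: (log_poly (g v) n \Po ('X + (Complex 0 (2 * pi))%:P)).
Proof.
move=> hw' hv hgv; set c := Complex 0 (2 * pi).
have [nr|nr] := boolP (n \in r); last first.
  have lp0 u : coef_within u -> log_poly u n = 0.
    move=> hu; apply/polyP => q; rewrite coef_log_poly // coef0; apply/eqP.
    by apply: contraNT nr => /hu[].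
  by rewrite !lp0 // comp_poly0 scaler0.
pose Q a := log_poly v a - cexp2pi a *: (log_poly (g v) a \Po ('X + c%:P)).
suff : Q n = 0 by move/eqP; rewrite subr_eq0 => /eqP.
have [b hb] := seq_lower_bound [seq - Rei a | a <- r].
apply: (@exp_poly_zero _ r Q (1 - b) 0 0 0) => // [a ar|y _].
  by have := hb _ (map_f _ ar); lra.
rewrite !mul0r -[leRHS](cmod0 R) le_eqVlt; apply/orP; left; apply/eqP; congr cmod.
have z0 : (expR y)%:C != 0.
  by rewrite -(rmorph0 (real_complex R)) (inj_eq (@complexI R)) gt_eqF ?expR_gt0.
have [s [s1 s2]] := @tw_equiv _ _ _ W v x w' 0 _ hw' z0.
have e1 := sums_uniq s1 (log_poly_sums _ _ hgv).
have := sums_uniq s2 (log_poly_sums _ _ hv); rewrite e1 add0r lp0_exp lp_pos mulr1 -/c => /eqP.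
rewrite eq_sym -subr_eq0 -sumrB => /eqP {2}<-; apply: eq_bigr => a _.
rewrite /Q hornerD hornerN hornerZ horner_comp !hornerE mulrBr; congr (_ - _).
by rewrite mulrDr cexpD /cexp2pi -/c [c * a]mulrC mulrA.
Qed.

End Coefficients.

(** By induction on the order of nilpotency of [g - e^(2 pi i al)] one may assume
  that [v] is an eigenvector; then the monodromy relates a polynomial in [log z]
  to a multiple of its own translate, which has the same leading coefficient. *)
Lemma exponent_coset h al (v : V) (x : W) (w' : {scalar W}) n q :
  homogeneous g h al v -> graded_dual w' -> w' (tw_Y v x (n, q)) != 0 ->
  cexp2pi n * cexp2pi al = 1.
Proof.
move=> [hv gv _] hw'; apply: contraNeq => nal; apply/eqP.
have [m hm] := gv; elim: m v hv hm {gv} q => [|m IH] v hv hm q.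
  by rewrite (_ : v = 0) ?tw_Yl0 ?linear0 //; exact: hm.
have hgv := aut_wt hg hv.
have hu : vsa_wt h (eig_op g (cexp2pi al) v).
  by rewrite /eig_op addrC -scaleNr; exact: (gradingP (vsa_grading V)).
have {}IH := IH _ hu; rewrite -iterSr in IH; have {}IH := IH hm.
have [r1 [K1 h1]] := coef_finite x hv hw'; have [r2 [K2 h2]] := coef_finite x hgv hw'.
pose r := undup (r1 ++ r2); pose K := maxn K1 K2.
have {}h1 : coef_within x w' r K v.
  by move=> a b /h1[ar bK]; rewrite mem_undup mem_cat ar (leq_trans bK) // leq_maxl.
have {}h2 : coef_within x w' r K (g v).
  by move=> a b /h2[ar bK]; rewrite mem_undup mem_cat ar orbT (leq_trans bK) // leq_maxr.
have gE : log_poly x w' K (g v) n = cexp2pi al *: log_poly x w' K v n.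
  apply/polyP => a; rewrite coefZ !(coef_log_poly _ _ h1) !(coef_log_poly _ _ h2).
  have := IH a; rewrite /eig_op -scaleNr tw_YlD tw_YlZ linearD linearZ_LR /= mulNr => /eqP.
  by rewrite subr_eq0 => /eqP.
have := log_poly_monodromy (undup_uniq _) n hw' h1 h2; rewrite gE comp_polyZ scalerA.
set P := log_poly x w' K v n => PE; suff P0 : P = 0.
  by rewrite -(coef_log_poly _ _ h1) -/P P0 coef0.
apply/eqP; apply: contraNT nal => P0; have := congr1 lead_coef PE.
rewrite lead_coefZ lead_coef_comp ?size_XaddC // lead_coefXaddC expr1n mulr1 => /eqP.
rewrite -{1}[lead_coef P]mul1r (inj_eq (mulIf _)) ?lead_coef_eq0 // eq_sym.
by [].
Qed.

(** Weights bound the exponents of [z] below, equivariance puts them in one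
  coset of the integers, and the powers of the logarithm are bounded. *)
Lemma operator_support h al (v : V) (x : W) : lower_bounded W -> homogeneous g h al v ->
  exists A K, forall (w' : {scalar W}) d, graded_dual w' -> w' (tw_Y v x d) != 0 ->
  in_progressions A K d.
Proof.
move=> hW hv; have [hv1 _ _] := hv; have [B hB] := Y_lower_truncated hW x hv1.
have [K hK] := @tw_Y_log _ _ _ W v x.
exists [:: (Num.floor (B + Rei al))%:~R - al], K => w' [n q] hw' nz; split.
  by rewrite /= ltnNge; apply: contra nz => /hK ->; rewrite linear0.
eexists; first exact: mem_head.
have := exponent_coset hv hw' nz; rewrite -cexp2piD => /cexp2pi_eq1[m nm].
have nE : n = m%:~R - al by rewrite -nm addrK.
have Bm : (Num.floor (B + Rei al) <= m)%R.
  rewrite -(ler_int R); apply: le_trans (floor_le _) _; rewrite -lerBrDr.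
  rewrite leNgt; apply: contra nz => nB; rewrite hB ?linear0 // nE ReD ReN.
  by have -> : Rei (m%:~R) = m%:~R by rewrite -(rmorph_int (real_complex R)).
exists `|m - Num.floor (B + Rei al)|%N; rewrite /= nE addrAC; congr (_ - _).
rewrite -[X in _ + X]/((Posz _)%:~R) gez0_abs ?subr_ge0 // rmorphB /=.
by rewrite addrC subrK.
Qed.

End ExponentCosets.

(** * Numerators of correlators *)

Section FiniteForms.
Variables (R : realType) (k : nat).
Local Notation exps := (R[i] * nat)%type.
Local Notation idx := {ffun 'I_k -> exps}.
Implicit Types (F : int -> ('I_k -> R[i]) -> R[i]) (ps : seq ('I_k * 'I_k)).
Implicit Types (L : seq (R[i] * idx)) (z : 'I_k -> R[i]).

(** Correlators are compared through these numerators: their equality is a finite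
  formal identity, which holds on all branches and all configurations as soon as
  it holds on one region. *)
Definition cleared F ps L : Prop := all (fun ij => ij.1 != ij.2) ps /\
  forall p z, in_config z -> F p z * diffs ps z = feval L (monos p z).

Definition clearable F : Prop := exists ps L, cleared F ps L.

Lemma monos_up p z i d : (forall l, z l != 0) ->
  monos p z (idx_up i d) = z i * monos p z d.
Proof. by move=> z0; rewrite (monos_dn p i _ z0) idx_upK. Qed.

Lemma diffs_cat ps1 ps2 z : diffs (ps1 ++ ps2) z = diffs ps1 z * diffs ps2 z.
Proof. exact: big_cat. Qed.

Lemma feval_diffs ps L : exists L', forall p z, in_config z ->
  feval L' (monos p z) = feval L (monos p z) * diffs ps z.
Proof.
elim: ps => [|[i j] ps [L' hL']].
  by exists L => p z _; rewrite /diffs big_nil mulr1.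
pose up i L := [seq (l.1, idx_up i l.2) | l <- L] : seq (R[i] * idx).
have upE l M p z : in_config z -> feval (up l M) (monos p z) = z l * feval M (monos p z).
  move=> [z0 _]; rewrite /feval big_map mulr_sumr; apply: eq_bigr => t _.
  by rewrite monos_up // mulrCA.
exists (up i L' ++ fscale (-1) (up j L')) => p z hz.
rewrite feval_cat feval_scale !upE // hL' // /diffs big_cons /=; ring.
Qed.

Lemma cleared_cat F ps ps' L : cleared F ps L -> all (fun ij => ij.1 != ij.2) ps' ->
  exists L', cleared F (ps ++ ps') L'.
Proof.
move=> [ok h] ok'; have [L' hL'] := feval_diffs ps' L; exists L'; split=> [|p z hz].
  by rewrite all_cat ok.
by rewrite diffs_cat mulrA h // hL'.
Qed.

Lemma cleared_catl F ps ps' L : cleared F ps L -> all (fun ij => ij.1 != ij.2) ps' ->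
  exists L', cleared F (ps' ++ ps) L'.
Proof.
move=> [ok h] ok'; have [L' hL'] := feval_diffs ps' L; exists L'; split=> [|p z hz].
  by rewrite all_cat ok' ok.
by rewrite diffs_cat mulrCA h // hL' // mulrC.
Qed.

Lemma clearable_add F1 F2 : clearable F1 -> clearable F2 ->
  clearable (fun p z => F1 p z + F2 p z).
Proof.
move=> [ps1 [L1 h1]] [ps2 [L2 h2]].
have [L1' [ok h1']] := cleared_cat h1 h2.1; have [L2' [_ h2']] := cleared_catl h2 h1.1.
exists (ps1 ++ ps2), (L1' ++ L2'); split=> // p z hz.
by rewrite mulrDl h1' // h2' // feval_cat.
Qed.

Lemma clearable_ext F1 F2 : (forall p z, in_config z -> F1 p z = F2 p z) ->
  clearable F1 -> clearable F2.
Proof.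
move=> E [ps [L [ok h]]]; exists ps, L; split=> // p z hz.
by rewrite -E // h.
Qed.

Lemma clearable_sum (J : Type) (r : seq J) (F : J -> int -> ('I_k -> R[i]) -> R[i]) :
  (forall n, clearable (F n)) -> clearable (fun p z => \sum_(n <- r) F n p z).
Proof.
move=> h; elim: r => [|n r IH].
  exists [::], [::]; split=> // p z _.
  by rewrite big_nil mul0r /feval big_nil.
apply: clearable_ext (clearable_add (h n) IH) => p z _; by rewrite big_cons.
Qed.

Lemma clearable_term f (al : 'I_k -> R[i]) (n : 'I_k -> nat) : config_rational f ->
  clearable (fun p z => f z * \prod_i (cexp (- al i * lp p (z i)) * lp p (z i) ^+ n i)).
Proof.
move=> [P [m [t fE]]].
pose D : seq ('I_k * 'I_k) := [seq ij : 'I_k * 'I_k <- enum {: 'I_k * 'I_k} | (ij.1 < ij.2)%N].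
have DE z : diffs (flatten (nseq t D)) z =
    (\prod_(i < k) \prod_(j < k | (i < j)%N) (z i - z j)) ^+ t.
  rewrite pair_big_dep /= (_ : \prod_(_ | _) _ = diffs D z); last first.
    by rewrite /diffs /D big_filter big_enum_cond; apply: eq_bigl => ij; rewrite ?andbT.
  elim: t {fE} => [|t IH]; first by rewrite /diffs big_nil.
  by rewrite /= diffs_cat IH exprS.
pose term (mo : mpoly.multinom k) := (mpoly.mcoeff mo P,
  [ffun i => ((mpoly.fun_of_multinom mo i)%:R - m%:R - al i, n i)] : idx).
exists (flatten (nseq t D)), [seq term mo | mo <- mpoly.msupp P]; split.
  apply/allP => ij /flattenP[s /nseqP[-> _]]; rewrite mem_filter => /andP[lt _].
  by apply: contraTneq lt => ->; rewrite ltnn.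
move=> p z hz; have [z0 zd] := hz.
have D0 : (\prod_(i < k) \prod_(j < k | (i < j)%N) (z i - z j)) ^+ t != 0.
  apply: expf_neq0; apply/prodf_neq0 => i _; apply/prodf_neq0 => j ij.
  by rewrite subr_eq0 zd //; apply: contraTneq ij => ->; rewrite ltnn.
have E (a b c d : R[i]) : b != 0 -> a / (c * b) * d * b = a * (c^-1 * d).
  move=> b0; rewrite invfM -[RHS]mulr1 -(mulVf b0); ring.
rewrite DE fE // E // /feval big_map mpoly.mevalE mulr_suml; apply: eq_bigr => mo _ /=.
rewrite -mulrA; congr (_ * _); rewrite -prodrXl -prodfV -!big_split /=.
apply: eq_bigr => i _; rewrite ffunE /mono /= !mulrA; congr (_ * _).
by rewrite !mulrDl !mulNr !cexpD !cexpN !cexpMn cexp_lp.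
Qed.

End FiniteForms.

(** * Locality of a pair of operators *)

Section Locality.
Variables (R : realType) (V : vertex_superalgebra R) (g : {linear V -> V}).
Hypothesis hg : is_automorphism g.
Variable W : twisted_module g.
Hypothesis hW : lower_bounded W.
Local Notation "x %:C" := (real_complex R x).
Local Notation exps := (R[i] * nat)%type.

Definition pair_mono p (z1 z2 : R[i]) (d : exps * exps) : R[i] := mono p z1 d.1 * mono p z2 d.2.

Lemma pair_mul_sums p (z1 z2 : R[i]) (c : exps * exps -> R[i]) s t : z1 != 0 -> z2 != 0 ->
  abs_sums_to (fun d => c d * pair_mono p z1 z2 d) s ->
  abs_sums_to (fun d => iter t (@pair_mul R) c d * pair_mono p z1 z2 d) ((z1 - z2) ^+ t * s).
Proof.
move=> z10 z20 h; elim: t => [|t IH]; first by rewrite expr0 mul1r.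
rewrite exprS -mulrA iterS.
apply: (@diff_op_sums _ _ _ _ (fun d => (exp_up d.1, d.2)) (fun d => (d.1, exp_up d.2))) IH.
- by case=> d1 d2; rewrite /= /pair_dn1 exp_dnK.
- by case=> d1 d2; rewrite /= /pair_dn1 exp_upK.
- by case=> d1 d2; rewrite /= /pair_dn2 exp_dnK.
- by case=> d1 d2; rewrite /= /pair_dn2 exp_upK.
- by case=> d1 d2; rewrite /pair_mono /pair_dn1 /= (mono_pred p d1 z10) mulrA.
- by case=> d1 d2; rewrite /pair_mono /pair_dn2 /= (mono_pred p d2 z20) mulrCA.
Qed.

Lemma pair_mul_scale x (c : exps * exps -> R[i]) t d :
  iter t (@pair_mul R) (fun d => x * c d) d = x * iter t (@pair_mul R) c d.
Proof. by elim: t d => //= t IH d; rewrite /pair_mul /diff_op !IH mulrBr. Qed.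

Definition duality_list N (a : 'I_N.+1 -> 'I_N.+1 -> 'I_N.+1 -> 'I_N.+1 -> R[i])
    (m n : 'I_N.+1 -> R[i]) : seq (R[i] * (exps * exps)) :=
  [seq (a q.1.1.1 q.1.1.2 q.1.2 q.2, ((m q.1.1.1, q.1.2 : nat), (n q.1.1.2, q.2 : nat)))
    | q <- enum {: 'I_N.+1 * 'I_N.+1 * 'I_N.+1 * 'I_N.+1}].

Lemma duality_listE N a (m n : 'I_N.+1 -> R[i]) t p (z1 z2 : R[i]) : z1 != z2 ->
  (z1 - z2) ^+ t * tw_duality_fun a m n t p z1 z2 =
  feval (duality_list a m n) (pair_mono p z1 z2).
Proof.
move=> z12; rewrite /feval big_map big_enum /=.
pose T i j k l := a i j k l * pair_mono p z1 z2 ((m i, k : nat), (n j, l : nat)).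
rewrite -(pair_bigA _ (fun q l => T q.1.1 q.1.2 q.2 l)) /=.
rewrite -(pair_bigA _ (fun q k => \sum_l T q.1 q.2 k l)) /=.
rewrite -(pair_bigA _ (fun i j => \sum_k \sum_l T i j k l)) /=.
rewrite /tw_duality_fun mulr_sumr; apply: eq_bigr => i _.
rewrite mulr_sumr; apply: eq_bigr => j _; rewrite mulr_sumr; apply: eq_bigr => k _.
rewrite mulr_sumr; apply: eq_bigr => l _; rewrite /T /pair_mono /= mulrA.
by rewrite mulrC mulKf ?expf_neq0 ?subr_eq0 // mulrA.
Qed.

(** The flag chooses between the regions [|z1| > |z2|] and [|z2| > |z1|]. *)
Lemma pair_unique (y01 : bool) (c : exps * exps -> R[i]) :
  hsupp (fun (j : 'I_2) d => if (j == ord0) == y01 then d.1 else d.2) c ->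
  (forall y1 y2 : R, (if y01 then y2 < y1 else y1 < y2) ->
     abs_sums_to (fun d => c d * pair_mono 0 (expR y1)%:C (expR y2)%:C d) 0) ->
  forall d, c d = 0.
Proof.
move=> hc hs; pose j1 : 'I_2 := lift ord0 ord0.
apply: (series_unique _ hc) => [[d1 d2] [e1 e2] E|y hy].
  by have := E ord0; have := E j1; rewrite /=; case: (y01) => /= -> ->.
have lt10 := hy ord0 j1 isT.
case: y01 lt10 hc hs => lt10 hc hs.
  by apply: sums_eq (hs _ _ lt10) => [d|//]; rewrite !big_ord_recl big_ord0 mulr1.
apply: sums_eq (hs _ _ lt10) => [d|//].
by rewrite !big_ord_recl big_ord0 mulr1 /= [X in _ = _ * X]mulrC.
Qed.

Lemma pair_mul_hsupp y01 (c : exps * exps -> R[i]) t :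
  hsupp (fun (j : 'I_2) d => if (j == ord0) == y01 then d.1 else d.2) c ->
  hsupp (fun (j : 'I_2) d => if (j == ord0) == y01 then d.1 else d.2)
    (iter t (@pair_mul R) c).
Proof.
move=> hc; elim: t => //= t IH.
apply: (hsupp_diff (v1 := fun j => ((j == ord0) == y01)%:R)
  (v2 := fun j => ((j == ord0) != y01)%:R)) IH => i [[n1 q1] [n2 q2]];
by case: ifP => _; rewrite /= ?subr0.
Qed.

(** Both products expand the same function, in the regions [|z1| > |z2|] and
  [|z2| > |z1|]. Multiplied by the power of [z1 - z2] in its denominator, the
  function is a finite sum, whose coefficients both expansions must have. *)
Lemma pair_locality s1 s2 h1 h2 al1 al2 (u v : V) (x : W) (w' : {scalar W}) :
  homogeneous g h1 al1 u -> homogeneous g h2 al2 v -> parity s1 u -> parity s2 v ->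
  graded_dual w' -> exists t, forall d,
  iter t (@pair_mul R) (fun d => w' (tw_Y u (tw_Y v x d.2) d.1)) d =
  (-1) ^+ (s1 && s2) * iter t (@pair_mul R) (fun d => w' (tw_Y v (tw_Y u x d.1) d.2)) d.
Proof.
move=> hu hv pu pv hw'.
have [N [a [m [n [t ht]]]]] := @tw_dual _ _ _ W s1 s2 u v x w' pu pv hw'.
pose L := duality_list a m n.
have exp0 (y : R) : (expR y)%:C != 0.
  by rewrite -(rmorph0 (real_complex R)) (inj_eq (@complexI R)) gt_eqF ?expR_gt0.
have cexp_lt (y y' : R) : y < y' -> 0 < cmod (expR y)%:C < cmod (expR y')%:C.
  by rewrite !cmodC !ger0_norm ?expR_ge0 // expR_gt0 ltr_expR.
have neq_exp (y y' : R) : y < y' -> (expR y)%:C != (expR y')%:C.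
  by move=> yy; rewrite (inj_eq (@complexI R)) lt_eqF // ltr_expR.
exists t => d; rewrite -pair_mul_scale.
transitivity (fcoef L d); last apply: esym; apply/eqP; rewrite -subr_eq0; apply/eqP; move: d.
  apply: (@pair_unique true); last first.
    move=> y1 y2 lt12; have [+ _ _ _] := ht 0 (expR y1)%:C (expR y2)%:C.
    move/(_ (cexp_lt _ _ lt12)) => hs.
    have := @pair_mul_sums 0 _ _ (fun d => w' (tw_Y u (tw_Y v x d.2) d.1)) _ t (exp0 y1) (exp0 y2)
      (sums_eq (fun d => esym (mulrA _ _ _)) (erefl _) hs).
    rewrite duality_listE ?(eq_sym (expR y1)%:C) ?neq_exp // => h.
    apply: sums_eq (sums_sub h (feval_sums L (pair_mono 0 (expR y1)%:C (expR y2)%:C))); last by rewrite subrr.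
    by move=> d; rewrite mulrBl.
  apply: hsupp_sub (hsupp_fcoef _ _); apply: pair_mul_hsupp => j e.
  case: (unliftP ord0 j) => [j' ->|->] /=.
    have [A [K AK]] := operator_support hg x hW hv; exists A, K => -[d1 d2] _ /=.
    by have [w1 hw1 <-] := dual_Y d1 hu hw'; exact: AK.
  have [A [K AK]] := operator_support hg (tw_Y v x e.2) hW hu; exists A, K => -[d1 d2] /=.
  by move=> /(_ (lift ord0 ord0) isT) /= -> ; exact: AK.
apply: (@pair_unique false); last first.
  move=> y1 y2 lt12; have [_ + _ _] := ht 0 (expR y1)%:C (expR y2)%:C.
  move/(_ (cexp_lt _ _ lt12)) => hs.
  have := @pair_mul_sums 0 _ _ (fun d => (-1) ^+ (s1 && s2) * w' (tw_Y v (tw_Y u x d.1) d.2)) _ t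
    (exp0 y1) (exp0 y2) (sums_eq (fun d => esym (mulrA _ _ _)) (erefl _) hs).
  rewrite duality_listE ?neq_exp // => h.
  apply: sums_eq (sums_sub h (feval_sums L (pair_mono 0 (expR y1)%:C (expR y2)%:C))); last by rewrite subrr.
  by move=> d; rewrite mulrBl.
apply: hsupp_sub (hsupp_fcoef _ _); apply: pair_mul_hsupp; apply: hsupp_scale => j e.
case: (unliftP ord0 j) => [j' ->|->] /=.
  have [A [K AK]] := operator_support hg x hW hu; exists A, K => -[d1 d2] _ /=.
  by have [w1 hw1 <-] := dual_Y d2 hv hw'; exact: AK.
have [A [K AK]] := operator_support hg (tw_Y u x e.1) hW hv; exists A, K => -[d1 d2] /=.
by move=> /(_ (lift ord0 ord0) isT) /= -> ; exact: AK.
Qed.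

End Locality.

(** * Exchange of adjacent operators *)

Section Products.
Variables (R : realType) (V : vertex_superalgebra R) (g : {linear V -> V}).
Hypothesis hg : is_automorphism g.
Variable W : twisted_module g.
Hypothesis hW : lower_bounded W.
Local Notation "x %:C" := (real_complex R x).
Local Notation exps := (R[i] * nat)%type.
Variables (k : nat) (w : W) (w' : {scalar W}).
Hypothesis hw' : graded_dual w'.
Local Notation idx := {ffun 'I_k -> exps}.
Variables (h : 'I_k -> int) (al : 'I_k -> R[i]) (v : 'I_k -> V).
Hypothesis hv : forall i, homogeneous g (h i) (al i) (v i).

Definition exp_point (x : 'I_k -> R) (i : 'I_k) : R[i] := (expR (x i))%:C.

(** The index records the exponents of the original variables, whatever the order
  [s] of the operators, to make the coefficients of two orders comparable. *)
Definition prod_coef (s : 'S_k) (d : idx) : R[i] :=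
  w' (foldr (fun i x => tw_Y (v (s i)) x (d (s i))) w (enum 'I_k)).

Lemma enum_ord_split (j : 'I_k) : enum 'I_k = take j (enum 'I_k) ++ j :: drop j.+1 (enum 'I_k).
Proof.
rewrite -{1}(cat_take_drop j (enum 'I_k)) (drop_nth j) ?size_enum_ord //.
by rewrite nth_ord_enum.
Qed.

Lemma mem_drop_enum (j i : 'I_k) : i \in drop j (enum 'I_k) -> (j <= i)%N.
Proof.
move=> /(nthP j)[n]; rewrite size_drop size_enum_ord nth_drop => nk.
have lt : (j + n < k)%N by rewrite -ltn_subRL.
by move=> E; have := nth_ord_enum j (Ordinal lt); rewrite /= E => ->; exact: leq_addr.
Qed.

Lemma foldr_eq_in (T U : eqType) (f1 f2 : T -> U -> U) (x : U) (s : seq T) :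
  (forall i, i \in s -> f1 i =1 f2 i) -> foldr f1 x s = foldr f2 x s.
Proof.
elim: s => //= i s IH E; rewrite IH; first by apply: E; rewrite mem_head.
by move=> j js; apply: E; rewrite inE js orbT.
Qed.

Lemma hsupp_prod_coef (s : 'S_k) : hsupp (fun j (d : idx) => d (s j)) (prod_coef s).
Proof.
move=> j e; set u := foldr (fun i x => tw_Y (v (s i)) x (e (s i))) w (drop j.+1 (enum 'I_k)).
have [A [K AK]] := operator_support hg u hW (hv (s j)); exists A, K => d de.
rewrite /prod_coef (enum_ord_split j) foldr_cat /=.
have -> : foldr (fun i x => tw_Y (v (s i)) x (d (s i))) w (drop j.+1 (enum 'I_k)) = u.
  apply: foldr_eq_in => i id x; rewrite de //.
  have [jk|jk] := ltnP j.+1 k; first by apply: (@mem_drop_enum (Ordinal jk)).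
  by rewrite drop_oversize ?size_enum_ord // in id.
have [w1 hw1 <-] := @dual_prefix _ _ _ W k (h \o s) (al \o s) (v \o s) (d \o s)
  (take j (enum 'I_k)) w' (fun i => hv (s i)) hw'.
exact: AK.
Qed.

Lemma exp_point_config (s : 'S_k) (x : 'I_k -> R) :
  (forall i j : 'I_k, (i < j)%N -> x (s j) < x (s i)) -> in_config (exp_point x).
Proof.
move=> hx; split=> [i|i j ij].
  by rewrite -(rmorph0 (real_complex R)) (inj_eq (@complexI R)) gt_eqF ?expR_gt0.
rewrite (inj_eq (@complexI R)) (inj_eq (@expR_inj R)) -(permKV s i) -(permKV s j).
have : s^-1%g i != s^-1%g j by rewrite (inj_eq perm_inj).
by rewrite neq_ltn => /orP[/hx/gt_eqF ->|/hx/lt_eqF ->].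
Qed.

(** Both sides are the coefficients of expansions of the same function in the region
  of the order [s]. *)
Lemma prod_coef_cleared (s : 'S_k) (F : int -> ('I_k -> R[i]) -> R[i]) ps L :
  (forall x, (forall i j : 'I_k, (i < j)%N -> x (s j) < x (s i)) ->
     abs_sums_to (fun d => prod_coef s d * monos 0 (exp_point x) d) (F 0 (exp_point x))) ->
  cleared F ps L -> forall d, mul_diffs ps (prod_coef s) d = fcoef L d.
Proof.
move=> hs [_ hF] d; apply/eqP; rewrite -subr_eq0; apply/eqP; move: d.
apply: (series_unique (pr := fun j (d : idx) => d (s j))).
- by move=> d d' E; apply/ffunP => i; rewrite -(permKV s i).
- by apply: hsupp_sub (hsupp_fcoef _ _); apply: hsupp_mul_diffs; exact: hsupp_prod_coef.
move=> y hy; pose x i := y (s^-1%g i).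
have hx (i j : 'I_k) : (i < j)%N -> x (s j) < x (s i) by rewrite /x !permK; exact: hy.
have hc := exp_point_config hx.
have h1 := mul_diffs_sums ps hc.1 (hs x hx).
rewrite mulrC hF // in h1.
apply: sums_eq (sums_sub h1 (feval_sums L (monos 0 (exp_point x)))); last by rewrite subrr.
move=> d; rewrite -mulrBl; congr (_ * _); rewrite /monos (reindex_inj (@perm_inj _ s)).
by apply: eq_bigr => j _; rewrite /exp_point /x permK.
Qed.

Lemma monos_perm (s : 'S_k) p (z : 'I_k -> R[i]) (d : idx) :
  monos p (fun i => z (s i)) d = monos p z [ffun i => d (s^-1%g i)].
Proof.
rewrite /monos [RHS](reindex_inj (@perm_inj _ s)); apply: eq_bigr => i _.
by rewrite ffunE permK.
Qed.

Lemma in_config_perm (s : 'S_k) (z : 'I_k -> R[i]) :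
  in_config z -> in_config (fun i => z (s i)).
Proof.
by move=> [z0 zd]; split=> // i j ij; apply: zd; rewrite (inj_eq perm_inj).
Qed.

Lemma clearable_perm (s : 'S_k) (F : int -> ('I_k -> R[i]) -> R[i]) :
  clearable F -> clearable (fun p z => F p (fun i => z (s i))).
Proof.
move=> [ps [L [ok hF]]].
exists [seq (s ij.1, s ij.2) | ij <- ps],
  [seq (l.1, [ffun i => (l.2 : idx) (s^-1%g i)] : idx) | l <- L].
split=> [|p z hz].
  by rewrite all_map; apply: sub_all ok => ij /=; rewrite (inj_eq perm_inj).
have := hF p _ (in_config_perm s hz); rewrite /diffs /feval !big_map /= => ->.
by apply: eq_bigr => l _; rewrite monos_perm.
Qed.

Section Correlator.
Variable Phi : int -> ('I_k -> V) -> ('I_k -> R[i]) -> R[i].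
Hypothesis hPhi : is_correlator w' w Phi.

Lemma correlator_clearable (s : 'S_k) :
  clearable (fun p z => Phi p (fun i => v (s i)) (fun i => z (s i))).
Proof.
apply: (@clearable_perm s (fun p z => Phi p (fun i => v (s i)) z)).
have [|i|N [f [fr fE]]] := correlator_eigen hPhi (al := fun i => al (s i)) (v := fun i => v (s i)).
- by move=> i; have [] := hv (s i).
- by have [] := hv (s i).
apply: (clearable_ext (fun p z hz => esym ((fE p z).2 hz))).
by apply: clearable_sum => n; apply: (clearable_term _ (fun i => n i : nat)); exact: fr.
Qed.

Lemma correlator_sums (s : 'S_k) (x : 'I_k -> R) :
  (forall i j : 'I_k, (i < j)%N -> x (s j) < x (s i)) ->
  abs_sums_to (fun d => prod_coef s d * monos 0 (exp_point x) d)
    (Phi 0 (fun i => v (s i)) (fun i => exp_point x (s i))).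
Proof.
move=> hx.
have [|i|N [f [fr fE]]] := correlator_eigen hPhi (al := fun i => al (s i)) (v := fun i => v (s i)).
- by move=> i; have [] := hv (s i).
- by have [] := hv (s i).
have hc := in_config_perm s (exp_point_config hx).
have [h1 h2] := fE 0 (fun i => exp_point x (s i)).
rewrite (h2 hc).
have ho : in_ordered_region (fun i => exp_point x (s i)).
  split=> [i|i j ij]; first exact: hc.1.
  by rewrite /exp_point !cmodC !ger0_norm ?expR_ge0 // ltr_expR hx.
have := h1 ho.
move=> /(sums_reindex (f := fun d : idx => [ffun i => d (s i)] : idx)
  (f' := fun d : idx => [ffun i => d (s^-1%g i)] : idx)) => H.
have {}H := H (fun d => ltac:(by apply/ffunP => i; rewrite !ffunE permKV))
  (fun d => ltac:(by apply/ffunP => i; rewrite !ffunE permK)).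
apply: sums_eq H => // d; rewrite /product_term /prod_coef; congr (w' _ * _).
  by apply: foldr_eq_in => i _ y; rewrite ffunE.
rewrite /monos [RHS](reindex_inj (@perm_inj _ s)); apply: eq_bigr => i _.
by rewrite ffunE.
Qed.

Variables i0 j0 : 'I_k.
Hypothesis j0E : j0 = i0.+1 :> nat.
Variable par : 'I_k -> bool.
Hypothesis hpar : forall i, parity (par i) (v i).
Let tau := tperm i0 j0.

Lemma ord_lt_neq (i j : 'I_k) : (i < j)%N -> i != j.
Proof. by move=> ij; apply: contraTneq ij => ->; rewrite ltnn. Qed.

Lemma i0j0 : i0 != j0.
Proof. by apply: ord_lt_neq; rewrite j0E. Qed.

Lemma enum_ord_split2 :
  enum 'I_k = take i0 (enum 'I_k) ++ i0 :: j0 :: drop j0.+1 (enum 'I_k).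
Proof.
rewrite {1}(enum_ord_split i0) -j0E (drop_nth j0) ?size_enum_ord // nth_ord_enum.
by [].
Qed.

Lemma mem_prefix (i : 'I_k) : i \in take i0 (enum 'I_k) -> (i < i0)%N.
Proof.
move=> /(nthP i0)[n]; rewrite size_take size_enum_ord ltn_ord => ni.
rewrite nth_take // => E; have nk := ltn_trans ni (ltn_ord i0).
by have := nth_ord_enum i0 (Ordinal nk); rewrite /= E => ->.
Qed.

Lemma mem_suffix (i : 'I_k) : i \in drop j0.+1 (enum 'I_k) -> (j0 < i)%N.
Proof.
move=> id; have [jk|jk] := ltnP j0.+1 k; first by apply: (@mem_drop_enum (Ordinal jk)).
by rewrite drop_oversize ?size_enum_ord // in id.
Qed.

Lemma adjacent_local : local_null i0 j0 (fun d =>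
  prod_coef 1%g d - (-1) ^+ (par i0 && par j0) * prod_coef tau d).
Proof.
move=> e; set s1 := take i0 (enum 'I_k); set s2 := drop j0.+1 (enum 'I_k).
pose u := foldr (fun i x => tw_Y (v i) x (e i)) w s2.
have [w1 hw1 w1E] := dual_prefix e s1 hv hw'.
have [t ht] := pair_locality hg hW u (hv i0) (hv j0) (hpar i0) (hpar j0) hw1.
have e2 (x : exps * exps) i : i \in s1 ++ s2 -> set2 i0 j0 e x i = e i.
  rewrite mem_cat ffunE => /orP[/mem_prefix|/mem_suffix] ii.
    by rewrite !ifN // ord_lt_neq // j0E ltnS ltnW.
  by rewrite !ifN // eq_sym ord_lt_neq // (ltn_trans _ ii) // j0E.
have tauE i : i \in s1 ++ s2 -> tau i = i.
  rewrite mem_cat => /orP[/mem_prefix|/mem_suffix] ii; apply: tpermD.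
  - by rewrite eq_sym ord_lt_neq.
  - by rewrite eq_sym ord_lt_neq // j0E ltnS ltnW.
  - by rewrite ord_lt_neq // (ltn_trans _ ii) // j0E.
  - by rewrite ord_lt_neq.
have in1 i : i \in s1 -> i \in s1 ++ s2 by rewrite mem_cat => ->.
have in2 i : i \in s2 -> i \in s1 ++ s2 by rewrite mem_cat => ->; rewrite orbT.
have aE x : prod_coef 1%g (set2 i0 j0 e x) = w1 (tw_Y (v i0) (tw_Y (v j0) u x.2) x.1).
  rewrite /prod_coef enum_ord_split2 foldr_cat /= !perm1 w1E.
  congr (w' _); rewrite (_ : set2 _ _ _ _ i0 = x.1); last by rewrite ffunE eqxx.
  rewrite (_ : set2 _ _ _ _ j0 = x.2); last by rewrite ffunE eq_sym (negbTE i0j0) eqxx.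
  rewrite (@foldr_eq_in _ _ _ (fun i y => tw_Y (v i) y (e i)) _ s1).
    congr (foldr _ (tw_Y _ (tw_Y _ _ _) _) _); apply: foldr_eq_in => i /in2 is2 y.
    by rewrite perm1 e2.
  by move=> i /in1 is1 y; rewrite perm1 e2.
have bE x : prod_coef tau (set2 i0 j0 e x) = w1 (tw_Y (v j0) (tw_Y (v i0) u x.1) x.2).
  rewrite /prod_coef enum_ord_split2 foldr_cat /= tpermL tpermR w1E.
  congr (w' _); rewrite (_ : set2 _ _ _ _ i0 = x.1); last by rewrite ffunE eqxx.
  rewrite (_ : set2 _ _ _ _ j0 = x.2); last by rewrite ffunE eq_sym (negbTE i0j0) eqxx.
  rewrite (@foldr_eq_in _ _ _ (fun i y => tw_Y (v i) y (e i)) _ s1).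
    congr (foldr _ (tw_Y _ (tw_Y _ _ _) _) _); apply: foldr_eq_in => i /in2 is2 y.
    by rewrite tauE // e2.
  by move=> i /in1 is1 y; rewrite tauE // e2.
exists t => d ed; rewrite (same_fiber_set2 ed) iter_mul_diff_set2 //; last exact: i0j0.
have iterB (a b : exps * exps -> R[i]) n y : iter n (@pair_mul R) (fun d => a d - b d) y =
    iter n (@pair_mul R) a y - iter n (@pair_mul R) b y.
  by elim: n y => //= n IH y; rewrite /pair_mul /diff_op !IH; ring.
rewrite iterB pair_mul_scale; apply/eqP; rewrite subr_eq0; apply/eqP.
under eq_fun do rewrite aE; under [in RHS]eq_fun do rewrite bE.
exact: ht.
Qed.

(** The difference of the numerators of the two orders over a common denominator is
  a finite sum, annihilated by a power of [z_(i0) - z_(j0)] for each choice of the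
  other exponents; hence it is zero. *)
Lemma adjacent_swap p (z : 'I_k -> R[i]) : in_config z ->
  Phi p v z = (-1) ^+ (par i0 && par j0) * Phi p (fun i => v (tau i)) (fun i => z (tau i)).
Proof.
move=> hz; set ep := (-1) ^+ _.
have [ps1 [L1 h1]] := correlator_clearable 1%g; have [ps2 [L2 h2]] := correlator_clearable tau.
have [L1' h1'] := cleared_cat h1 h2.1; have [L2' h2'] := cleared_catl h2 h1.1.
have c1 := prod_coef_cleared (@correlator_sums 1%g) h1'.
have c2 := prod_coef_cleared (@correlator_sums tau) h2'.
set ps := ps1 ++ ps2 in c1 c2 h1' h2'.
have E d : fcoef L1' d = fcoef (fscale ep L2') d.
  apply/eqP; rewrite -subr_eq0; apply/eqP; move: d.
  apply: (local_eventually_zero i0j0); last first.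
    by apply: eventually_zeroB; exact: (eventually_zero_fcoef i0j0).
  rewrite (_ : (fun d => _) = mul_diffs ps (fun d => prod_coef 1%g d - ep * prod_coef tau d)).
    by apply: local_null_mul_diffs; exact: adjacent_local.
  by apply/funext => d; rewrite mul_diffsB c1 c2 fcoef_scale.
have d0 : diffs ps z != 0.
  rewrite /diffs prodf_seq_neq0; apply/allP => ij ijps; apply/implyP => _.
  by rewrite subr_eq0; apply: hz.2; exact: (allP h1'.1).
apply: (mulIf d0); rewrite -mulrA (h2'.2 p z hz) -feval_scale -(feval_eq _ E) -(h1'.2 p z hz).
congr (Phi p _ _ * _); apply/funext => i; by rewrite perm1.
Qed.

End Correlator.
End Products.

(** * Signs, multilinearity and the general permutation *)

Section KoszulSign.
Variable k : nat.
Implicit Types r : 'I_k -> 'I_k -> bool.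

Definition pair_count (r : 'I_k -> 'I_k -> bool) : nat :=
  \sum_(ij : 'I_k * 'I_k | (ij.1 < ij.2)%N) r ij.1 ij.2.

Lemma pair_count_addb r (r' : 'I_k -> 'I_k -> bool) :
  odd (pair_count (fun i j => r i j (+) r' i j)) = odd (pair_count r) (+) odd (pair_count r').
Proof.
rewrite /pair_count; elim/big_rec3: _ => //= ij a b c _ E.
by rewrite !oddD E !oddb; case: (r _ _); case: (r' _ _); case: (odd a); case: (odd b).
Qed.

Lemma eq_pair_count r (r' : 'I_k -> 'I_k -> bool) : (forall i j : 'I_k, (i < j)%N -> r i j = r' i j) ->
  pair_count r = pair_count r'.
Proof. by move=> E; apply: eq_bigr => ij lt; rewrite E. Qed.

Lemma pair_count_double r : (forall i j, r i j = r j i) ->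
  (\sum_(ij : 'I_k * 'I_k | ij.1 != ij.2) r ij.1 ij.2 = pair_count r + pair_count r)%N.
Proof.
move=> sym; rewrite (bigID (fun ij : 'I_k * 'I_k => (ij.1 < ij.2)%N)) /=; congr (_ + _)%N.
  apply: eq_bigl => ij; apply: andb_idl => lt.
  by apply: contraTneq lt => ->; rewrite ltnn.
rewrite (reindex (fun ij : 'I_k * 'I_k => (ij.2, ij.1))) /=; last first.
  by exists (fun ij => (ij.2, ij.1)) => -[].
rewrite /pair_count; apply: eq_big => [ij|ij _]; last by rewrite sym.
by rewrite -leqNgt [RHS]ltn_neqAle eq_sym.
Qed.

(** For a symmetric relation, twice the count is a sum over all ordered pairs of
  distinct indices, which is invariant under reindexing. *)
Lemma pair_count_perm r (s : 'S_k) : (forall i j, r i j = r j i) ->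
  pair_count (fun i j => r (s i) (s j)) = pair_count r.
Proof.
move=> sym; apply: double_inj; rewrite -!addnn -!pair_count_double //.
rewrite [RHS](reindex (fun ij : 'I_k * 'I_k => (s ij.1, s ij.2))) /=; last first.
  by exists (fun ij => (s^-1%g ij.1, s^-1%g ij.2)) => -[i j] _ /=; rewrite ?permK ?permKV.
by apply: eq_bigl => ij; rewrite (inj_eq perm_inj).
Qed.

Lemma koszulE (par : 'I_k -> bool) (s : 'S_k) : koszul par s = pair_count
  (fun i j => [&& par (s i), par (s j) & (i < j)%N (+) (s i < s j)%N]).
Proof.
rewrite /koszul -sum1_card /pair_count [RHS]big_mkcond [LHS]big_mkcond /=.
apply: eq_bigr => -[i j] _; rewrite !inE /=; case: ltnP => //= ij.
have : s i != s j :> nat.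
  by rewrite (inj_eq val_inj) (inj_eq perm_inj); apply: contraTneq ij => ->; rewrite ltnn.
by case: ltngtP => //= _; case: (par (s i)); case: (par (s j)).
Qed.

(** A pair is exchanged by [s * t] if and only if exactly one of [s], on the pair,
  and [t], on the image of the pair, exchanges it; and counting unordered pairs is
  insensitive to a permutation of the indices. *)
Lemma koszul_comp (par : 'I_k -> bool) (s t : 'S_k) :
  odd (koszul par (s * t)%g) = odd (koszul par t) (+) odd (koszul (fun i => par (t i)) s).
Proof.
pose r i j := [&& par (t i), par (t j) & (i < j)%N (+) (t i < t j)%N && (i != j)].
have rE : koszul par t = pair_count r.
  rewrite koszulE; apply: eq_pair_count => i j ij; rewrite /r.
  by rewrite (_ : i != j) ?andbT //; apply: contraTneq ij => ->; rewrite ltnn.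
have rsym i j : r i j = r j i.
  rewrite /r [j == i]eq_sym; have [->|ij] := eqVneq i j; first by rewrite !andbF.
  have tij : t i != t j :> nat by rewrite (inj_eq val_inj) (inj_eq perm_inj).
  have nij : i != j :> nat by [].
  rewrite !andbT andbCA; congr (_ && (_ && _)).
  by case: (ltngtP i j) nij => //; case: (ltngtP (t i) (t j)) tij.
rewrite rE -(pair_count_perm s rsym) !koszulE -pair_count_addb; congr odd.
apply: eq_pair_count => i j ij; rewrite /r !permM.
have -> : s i != s j by rewrite (inj_eq perm_inj); apply: contraTneq ij => ->; rewrite ltnn.
rewrite andbT; case: (par _) => //=; case: (par _) => //=.
by case: (i < j)%N; case: (s i < s j)%N; case: (t (s i) < t (s j))%N.
Qed.

Lemma koszul_adjacent (par : 'I_k -> bool) (i j : 'I_k) : j = i.+1 :> nat ->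
  koszul par (tperm i j) = (par i && par j) :> nat.
Proof.
move=> ijE; rewrite /koszul.
have lt : (i < j)%N by rewrite ijE.
rewrite (eq_card (B := [pred ab | (ab == (i, j)) && (par i && par j)])) => [|[a b]].
  case: (par i && par j); last by apply: eq_card0 => ab; rewrite !inE andbF.
  by rewrite -[RHS]/1%N -(card1 (i, j)); apply: eq_card => ab; rewrite !inE ?andbT.
rewrite !inE /=; have [/eqP[-> ->]|ne] := boolP ((a, b) == (i, j)).
  by rewrite tpermL tpermR lt /= andbC.
apply/negbTE; apply: contra ne => /and4P[ab tba _ _].
have tE x : [\/ tperm i j x = j :> nat /\ x = i :> nat, tperm i j x = i :> nat /\ x = j :> nat |
    tperm i j x = x :> nat /\ (x <> i :> nat) /\ (x <> j :> nat)].
  case: tpermP => [->|->|ni nj]; [by constructor 1|by constructor 2|constructor 3].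
  by split=> //; split=> [/val_inj/ni|/val_inj/nj].
have key (c d : 'I_k) : (c < d)%N -> (tperm i j d < tperm i j c)%N ->
    c = i :> nat /\ d = j :> nat.
  by case: (tE c) => [[-> ->]|[-> ->]|[-> [? ?]]]; case: (tE d) => [[-> ->]|[-> ->]|[-> [? ?]]]; lia.
have [ai bj] := key a b ab tba.
by rewrite -(val_inj ai) -(val_inj bj).
Qed.

End KoszulSign.

(** The transposition [(a b)] is conjugate to the shorter [(a b-1)] by the adjacent
  transposition [(b-1 b)]. *)
Lemma perm_adjacent_ind k (Q : 'S_k -> Prop) : Q 1%g ->
  (forall s t, Q s -> Q t -> Q (s * t)%g) ->
  (forall i j : 'I_k, j = i.+1 :> nat -> Q (tperm i j)) -> forall s, Q s.
Proof.
move=> Q1 QM Qadj s.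
have Qlt n : forall a b : 'I_k, (b = a + n.+1 :> nat)%N -> Q (tperm a b).
  elim: n => [|n IH] a b ab; first by apply: Qadj; rewrite ab addn1.
  have ck : (a + n.+1 < k)%N by rewrite (leq_ltn_trans _ (ltn_ord b)) // ab leq_add2l.
  pose c := Ordinal ck.
  have ca : c != a by rewrite -val_eqE /= -[X in _ != X]addn0 eqn_add2l.
  have ba : b != a by rewrite -val_eqE /= ab -[X in _ != X]addn0 eqn_add2l.
  have bc : b = c.+1 :> nat by rewrite ab addnS.
  have -> : tperm a b = (tperm c b * tperm a c * tperm c b)%g.
    have <- : tperm (tperm c b a) (tperm c b c) = tperm a b by rewrite tpermD // tpermL.
    by rewrite -tpermJ conjgE tpermV mulgA.
  exact: (QM _ _ (QM _ _ (Qadj _ _ bc) (IH a c erefl)) (Qadj _ _ bc)).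
have [ts -> _] := prod_tpermP s; elim/big_rec: _ => // -[i j] t _ Qt.
apply: (QM _ _ _ Qt) => /=.
case: (ltngtP i j) => [ij|ij|/val_inj ->]; last by rewrite tperm1.
  by apply: (Qlt (j - i.+1)%N); rewrite -subSn // subSS subnKC // ltnW.
by rewrite tpermC; apply: (Qlt (i - j.+1)%N); rewrite -subSn // subSS subnKC // ltnW.
Qed.

Section MultilinearExtension.
Variables (R : realType) (E : lmodType R[i]) (k : nat).
Implicit Types (A B : ('I_k -> E) -> R[i]) (S : 'I_k -> E -> Prop).

Definition replace (v : 'I_k -> E) (i : 'I_k) (x : E) := fun j => if j == i then x else v j.

Definition multilinear A : Prop := forall v i, scalar (fun x => A (replace v i x)).

Lemma multilinear_sum A v i (l : seq E) : multilinear A ->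
  A (replace v i (\sum_(x <- l) x)) = \sum_(x <- l) A (replace v i x).
Proof.
move=> hA; have add x y : A (replace v i (x + y)) = A (replace v i x) + A (replace v i y).
  by have := hA v i 1 x y; rewrite scale1r mul1r.
have zero : A (replace v i 0) = 0.
  by have /eqP := add 0 0; rewrite addr0 -subr_eq0 opprD addNKr oppr_eq0 => /eqP.
exact: (big_morph (fun x => A (replace v i x)) add zero).
Qed.

Lemma multilinear_eq A B S : multilinear A -> multilinear B ->
  (forall v, (forall i, S i (v i)) -> A v = B v) ->
  forall v, (forall i, exists2 l : seq E, v i = \sum_(x <- l) x & forall x, x \in l -> S i x) ->
  A v = B v.
Proof.
move=> hA hB AB.
suff H m : forall v, (forall i : 'I_k, (i < m)%N ->
      exists2 l : seq E, v i = \sum_(x <- l) x & forall x, x \in l -> S i x) ->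
    (forall i : 'I_k, (m <= i)%N -> S i (v i)) -> A v = B v.
  by move=> v hv; apply: (H k) => // i; rewrite leqNgt ltn_ord.
elim: m => [|m IH] v h1 h2; first by apply: AB => i; exact: h2.
have [mk|km] := ltnP m k; last first.
  apply: IH => [i im|i mi]; first by apply: h1; rewrite ltnS ltnW.
  by have := leq_trans km mi; rewrite leqNgt ltn_ord.
pose i := Ordinal mk; have [l lE hl] := h1 i (ltnSn m).
have -> : v = replace v i (\sum_(x <- l) x).
  by apply/funext => j; rewrite /replace; case: eqP => // ->.
rewrite !multilinear_sum // !big_seq; apply: eq_bigr => x xl; apply: IH => j jm.
  rewrite /replace ifN; first by apply: h1; rewrite ltnS ltnW.
  by apply: contraTneq jm => ->; rewrite ltnn.
rewrite /replace; case: eqP => [->|/eqP ji]; first exact: hl.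
by apply: h2; rewrite ltn_neqAle jm andbT; apply: contra ji => /eqP E'; apply/eqP/val_inj.
Qed.

End MultilinearExtension.

Section Commutativity.
Variables (R : realType) (V : vertex_superalgebra R) (g : {linear V -> V}).
Hypothesis hg : is_automorphism g.
Variable W : twisted_module g.
Hypothesis hW : lower_bounded W.
Variables (k : nat) (w : W) (w' : {scalar W}).
Hypothesis hw' : graded_dual w'.
Variable Phi : int -> ('I_k -> V) -> ('I_k -> R[i]) -> R[i].
Hypothesis hPhi : is_correlator w' w Phi.

Lemma parity_span s (v : V) : parity s v -> exists2 l : seq V, v = \sum_(x <- l) x &
  forall x, x \in l -> exists h al, homogeneous g h al x /\ odd `|h|%N = s.
Proof.
move=> [J [f [hf ->]]].
have : forall h, h \in enum_fset J -> vsa_wt h (f h) /\ odd `|h|%N = s.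
  by move=> h /hf[].
elim: (enum_fset J) => [|h r IH] hr; first by exists [::]; rewrite ?big_nil.
have [|l lE hl] := IH; first by move=> a ar; apply: hr; rewrite inE ar orbT.
have [hh hs] := hr h (mem_head _ _).
have [l' l'E hl'] := homogeneous_span hg hh.
exists (l' ++ l); first by rewrite big_cons big_cat l'E lE.
move=> x; rewrite mem_cat => /orP[/hl'[al]|/hl//]; by exists h, al.
Qed.

Lemma replace_perm (s : 'S_k) (v : 'I_k -> V) i x :
  (fun j => replace v i x (s j)) = replace (fun j => v (s j)) (s^-1%g i) x.
Proof.
apply/funext => j; rewrite /replace; congr (if _ then _ else _).
by rewrite (can2_eq (permK s) (permKV s)).
Qed.

Lemma transposition_sign (par : 'I_k -> bool) (v : 'I_k -> V) p (z : 'I_k -> R[i]) (i j : 'I_k) :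
  j = i.+1 :> nat -> (forall i, parity (par i) (v i)) -> in_config z ->
  Phi p v z = (-1) ^+ (par i && par j) *
    Phi p (fun a => v (tperm i j a)) (fun a => z (tperm i j a)).
Proof.
move=> ijE hv hz; pose S a x := exists h al, homogeneous g h al x /\ odd `|h|%N = par a.
apply: (@multilinear_eq _ _ _ (fun v => Phi p v z) (fun v => (-1) ^+ (par i && par j) *
    Phi p (fun a => v (tperm i j a)) (fun a => z (tperm i j a))) S).
- by move=> u a; exact: (correlator_multilinear hPhi p u z a).
- move=> u a c x y; rewrite !replace_perm.
  by rewrite (correlator_multilinear hPhi) mulrDr mulrCA.
- move=> u /choice[h /choice[al hal]].
  apply: (adjacent_swap hg hW hw' (fun a => (hal a).1) hPhi ijE) => // a.
  by have [[hh _ _] <-] := hal a; exact: wt_parity.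
- by move=> a; exact: parity_span.
Qed.

Lemma permutation_sign (sigma : 'S_k) : forall (par : 'I_k -> bool) (v : 'I_k -> V) p
    (z : 'I_k -> R[i]), (forall i, parity (par i) (v i)) -> in_config z ->
  Phi p v z = (-1) ^+ koszul par sigma *
    Phi p (fun i => v (sigma i)) (fun i => z (sigma i)).
Proof.
elim/perm_adjacent_ind: sigma => [|s t IHs IHt|i j ijE] par v p z hv hz.
- rewrite (_ : koszul par 1 = 0%N); last first.
    by apply: eq_card0 => -[a b]; rewrite !inE /= !perm1; case: ltngtP.
  by rewrite mul1r; congr (Phi p _ _); apply/funext => i; rewrite perm1.
- rewrite (IHt par) // (IHs (fun i => par (t i))) //; last exact: in_config_perm.
  rewrite mulrA -signr_odd -[X in _ * X * _]signr_odd -[in RHS]signr_odd koszul_comp signr_addb.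
  by congr (_ * Phi p _ _); apply/funext => i; rewrite permM.
- by rewrite koszul_adjacent //; exact: transposition_sign.
Qed.

End Commutativity.

Theorem corollary3p11 (R : realType) (V : vertex_superalgebra R)
    (g : {linear V -> V}) (hg : is_automorphism g)
    (W : twisted_module g) (hW : lower_bounded W)
    (k : nat) (v : 'I_k -> V) (s : 'I_k -> bool)
    (hs : forall i, parity (s i) (v i))
    (w : W) (w' : {scalar W}) (hw' : graded_dual w')
    (p : int) (sigma : 'S_k) (z : 'I_k -> R[i]) (hz : in_config z) :
  Fp w' w p v z =
  (-1) ^+ koszul s sigma *
    Fp w' w p (fun i => v (sigma i)) (fun i => z (sigma i)).
Proof.
rewrite /Fp; have [[Phi hPhi]|no] := pselect (exists Phi, @is_correlator R V g W k w' w Phi).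
  have := xgetPex (fun _ _ _ => 0) (ex_intro [set F | is_correlator w' w F]%classic Phi hPhi).
  set F := xget _ _ => hF; exact: (permutation_sign hg hW hw' hF sigma).
by rewrite xgetPN ?mulr0 // => F hF; apply: no; exists F.
Qed.
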